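(* Let $(A,m_A,\langle\,,\rangle_A)$ and $(B,m_B,\langle\,,\rangle_B)$ be two cyclic (gapped filtered) $A_\infty$-algebras, and let $h=\{h_k\}_{k\ge1}:A\to B$ be a cyclic $A_\infty$-homomorphism. Then $h$ preserves the value of $m^+$: for every Hochschild cycle (or chain) $\alpha\in C_\bullet(A,A)$, $$m_A^+(\alpha)=m_B^+(\widehat h(\alpha)).$$
   Context: **Novikov ring.** Let $\boldsymbol{k}$ be a field of characteristic $0$. $\Lambda_{0,nov}$ is the ring of formal sums $\sum_{i\ge0}a_iT^{\lambda_i}e^{q_i}$ with $a_i\in\boldsymbol{k}$, $\lambda_i\in\mathbb{R}_{\ge0}$, $q_i\in\mathbb{Z}$, $\lim\lambda_i=\infty$; $T,e$ are formal parameters of degrees $0$ and $2$. **Filtered $A_\infty$-algebra.** $G\subset\mathbb{R}_{\ge0}\times2\mathbb{Z}$ is a monoid whose projection to $\mathbb{R}_{\ge0}$ is discrete, with $G\cap(\{0\}\times2\mathbb{Z})=\{(0,0)\}$ and $G\cap(\{\lambda\}\times2\mathbb{Z})$ finite for all $\lambda$. $A=\overline A\otimes_{\boldsymbol{k}}\Lambda_{0,nov}$ with $\overline A$ a finite-dimensional graded $\boldsymbol{k}$-vector space; $|x|'=|x|-1$ is the shifted degree (degree in $A[1]$). For $k\ge0$ and $\beta=(\lambda(\beta),\mu(\beta))\in G$ there are maps $m_{k,\beta}:\overline A[1]^{\otimes k}\to\overline A[1]$ with $m_{0,(0,0)}=0$, and $m_k=\sum_{\beta\in G}T^{\lambda(\beta)}e^{\mu(\beta)/2}m_{k,\beta}$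 is of degree $1$. Set $$\widehat m_k(x_1\otimes\cdots\otimes x_n)=\sum_{i=1}^{n-k+1}(-1)^{|x_1|'+\cdots+|x_{i-1}|'}x_1\otimes\cdots\otimes m_k(x_i,\dots,x_{i+k-1})\otimes\cdots\otimes x_n$$ for $k\le n$, and $0$ for $k>n$, and $\widehat d=\sum_{k\ge0}\widehat m_k$. The $A_\infty$-equations are $\widehat d\circ\widehat d=0$. **Cyclicity.** $A$ is cyclic if there is a non-degenerate bilinear map $\langle\,,\rangle:\overline A[1]\otimes\overline A[1]\to\boldsymbol{k}$, extended linearly to $A$, graded skew-symmetric ($\langle a,b\rangle=-(-1)^{|a|'|b|'}\langle b,a\rangle$), such that for all $k\ge0$, $\beta\in G$, $$\langle m_{k,\beta}(x_1,\dots,x_k),x_{k+1}\rangle=(-1)^K\langle m_{k,\beta}(x_2,\dots,x_{k+1}),x_1\rangle,\quad K=|x_1|'(|x_2|'+\cdots+|x_{k+1}|').$$ **The function $m^+$.** For $k\ge1$, $m^+(x_1\otimes\cdots\otimes x_k)=\langle m_{k-1}(x_1,\dots,x_{k-1}),x_k\rangle$, extended linearly (and continuously for the energy filtration). **Hochschild chains.** $C_\bullet(A,A)$ is the completion, with respect to the energy filtration, of $\bigoplus_{k\ge0}A[1]\otimes A[1]^{\otimes k}$, whose first (module) factor is underlined; $m^+(\underline{x_0}\otimes x_1\otimes\cdots\otimes x_k)=\langle m_k(x_0,\dots,x_{k-1}),x_k\rangle$. The Hochschild differential is $$d^{Hoch}(\underline v\otimes x_1\otimes\cdots\otimes x_k)=\sum_{i\ge1,\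 0\le j\le k+1-i}(-1)^{\epsilon_1}\underline v\otimes\cdots\otimes x_{i-1}\otimes m_j(x_i,\dots,x_{i+j-1})\otimes\cdots\otimes x_k$$ $$+\sum_{0\le i,j\le k,\ i+j\le k}(-1)^{\epsilon_2}\underline{m_{i+j+1}(x_{k-i+1},\dots,x_k,v,x_1,\dots,x_j)}\otimes x_{j+1}\otimes\cdots\otimes x_{k-i},$$ $\epsilon_1=|v|'+|x_1|'+\cdots+|x_{i-1}|'$, $\epsilon_2=\big(\sum_{s=1}^i|x_{k-i+s}|'\big)\big(|v|'+\sum_{t=1}^j|x_t|'\big)$. **Homomorphisms.** A (gapped filtered) $A_\infty$-homomorphism $h=\{h_k\}_{k\ge1}$ consists of filtration-preserving, degree $0$, $\Lambda_{0,nov}$-multilinear maps $h_k:A[1]^{\otimes k}\to B[1]$ whose induced cohomomorphism of tensor coalgebras, $x_1\otimes\cdots\otimes x_n\mapsto\sum h(x_1,\dots,x_{i_1})\otimes\cdots\otimes h(x_{i_{l-1}+1},\dots,x_n)$ (sum over all decompositions into consecutive non-empty blocks), intertwines $\widehat d_A$ and $\widehat d_B$. It is cyclic if (1) $\langle h_1(a),h_1(b)\rangle_B=\langle a,b\rangle_A$ for all $a,b$; and (2) for all $k\ge3$, $\sum_{i+j=k,\ i,j\ge1}\langle h_i(x_1,\dots,x_i),h_j(x_{i+1},\dots,x_k)\rangle_B=0$. The induced chain map $\widehat h:C_\bullet(A,A)\to C_\bullet(B,B)$ of Hochschild complexes is $$\widehat h(\underline{x_0}\otimes x_1\otimes\cdots\otimes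 x_k)=\sum(-1)^{\epsilon}\,\underline{h_{i+j+1}(x_{k-i+1},\dots,x_k,x_0,x_1,\dots,x_j)}\otimes h(x_{j+1},\dots)\otimes\cdots\otimes h(\dots,x_{k-i}),$$ summed over $i,j\ge0$ with $i+j\le k$ and all decompositions of $(x_{j+1},\dots,x_{k-i})$ into consecutive non-empty blocks, where $\epsilon=\big(\sum_{s=1}^i|x_{k-i+s}|'\big)\big(\sum_{t=0}^{k-i}|x_t|'\big)$ is the Koszul sign in shifted degrees. *)

(* Defs.v *)
From HB Require Import structures.
From mathcomp Require Import all_boot all_order all_algebra.
From mathcomp Require Import finmap.
From mathcomp Require Import boolp classical_sets functions cardinality fsbigop.
From mathcomp Require Import reals.
Set Implicit Arguments.
Unset Strict Implicit.
Unset Printing Implicit Defensive.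
Import Order.TTheory GRing.Theory Num.Theory.
Local Open Scope classical_set_scope.
Local Open Scope ring_scope.

Section Novikov.
Variables (R : realType) (K : fieldType).
Implicit Types (f g : R * int -> K^o) (E : R) (p r s : R * int).

(* [f (l, q)] is the coefficient of T^l e^q. *)
Definition novikov_series f : Prop :=
  (forall p, p.1 < 0 -> f p = 0) /\
  (forall E, finite_set [set p | p.1 <= E /\ f p <> 0]).

Definition novikov_pred : {pred R * int -> K^o} :=
  fun f => `[< novikov_series f >].

Record novikov := Novikov {
  nov_coef :> R * int -> K^o;
  nov_coefP : nov_coef \in novikov_pred }.

HB.instance Definition _ := [isSub for nov_coef].
HB.instance Definition _ := [Choice of novikov by <:].

Lemma novP (a : novikov) : novikov_series a.
Proof. exact/asboolP/(valP a). Qed.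

Lemma nov_eqP (a b : novikov) : (forall p, a p = b p) -> a = b.
Proof. by move=> ab; apply: val_inj; apply/funext. Qed.

Fact novikov_submod : submod_closed novikov_pred.
Proof.
split=> [|k f g /asboolP[f0 fE] /asboolP[g0 gE]]; apply/asboolP.
  split=> // E; apply: (sub_finite_set _ (finite_set0 _)) => p [_].
  by [].
have e p : (k *: f + g) p = k * f p + g p by [].
split=> [p p0|E]; first by rewrite e f0// g0// mulr0 addr0.
apply: (@sub_finite_set _ _ ([set p | p.1 <= E /\ f p <> 0] `|`
    [set p | p.1 <= E /\ g p <> 0])); last by rewrite finite_setU.
move=> p [pE]; rewrite e => kfg.
have [fp|/eqP fp] := eqVneq (f p) 0; last by left.
by right; split=> // gp; apply: kfg; rewrite fp gp mulr0 addr0.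
Qed.

HB.instance Definition _ :=
  GRing.isSubmodClosed.Build K (R * int -> K^o) novikov_pred novikov_submod.
HB.instance Definition _ := [SubChoice_isSubLmodule of novikov by <:].

Lemma nov_coefD (a b : novikov) p : (a + b) p = a p + b p. Proof. by []. Qed.
Lemma nov_coefN (a : novikov) p : (- a) p = - a p. Proof. by []. Qed.
Lemma nov_coefZ k (a : novikov) p : (k *: a) p = k * a p. Proof. by []. Qed.
Lemma nov_coef0 p : (0 : novikov) p = 0. Proof. by []. Qed.

Definition conv f g p : K := \sum_(r \in [set: R * int]) f r * g (p - r).

Definition covers E f (S : seq (R * int)) :=
  uniq S /\ forall p, p.1 <= E -> f p <> 0 -> p \in S.

Lemma coversP E (a : novikov) : exists S, covers E a S.
Proof.
have [_ /(_ E) fE] := novP a.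
exists (fset_set [set p | p.1 <= E /\ a p <> 0]); split; first exact: fset_uniq.
by move=> p pE ap; rewrite in_fset_set// inE.
Qed.

Lemma conv_seq E (a b : novikov) S p : covers E a S -> p.1 <= E ->
  conv a b p = \sum_(r <- S) a r * b (p - r).
Proof.
move=> [uS aS] pE; rewrite /conv (fsbigE S)//.
  by apply: eq_bigl => r; rewrite in_setT.
move=> r _ rS; have [aN _] := novP a; have [bN _] := novP b.
have [ar|/eqP ar] := eqVneq (a r) 0; first by rewrite ar mul0r.
rewrite bN ?mulr0//= subr_lt0; rewrite ltNge; apply/negP => rp.
by case/negP: rS; apply: aS ar; apply: le_trans pE.
Qed.

Lemma conv_seq2 E (a b : novikov) Sa Sb p : covers E a Sa -> covers E b Sb ->
  p.1 <= E -> conv a b p =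
    \sum_(r <- Sa) \sum_(s <- Sb) (if r + s == p then a r * b s else 0).
Proof.
move=> Ha [uSb bS] pE; rewrite (conv_seq _ Ha pE); apply: eq_bigr => r _.
rewrite -big_mkcond/=.
have e s : (r + s == p) = (s == p - r) by rewrite eq_sym addrC -subr_eq eq_sym.
rewrite (eq_bigl _ _ e).
have [pS|pS] := boolP (p - r \in Sb).
  by rewrite -big_filter filter_pred1_uniq// big_seq1.
rewrite big1_seq; last by move=> s /andP[/eqP ->]; rewrite (negbTE pS).
have [aN _] := novP a.
have [->|/eqP bp] := eqVneq (b (p - r)) 0; first by rewrite mulr0.
rewrite aN ?mul0r// ltNge; apply/negP => r0; case/negP: pS; apply: bS bp.
by rewrite /= lerBlDr (le_trans pE)// lerDl.
Qed.

Lemma conv_novikov (a b : novikov) : conv a b \in novikov_pred.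
Proof.
apply/asboolP; split=> [p p0|E].
  have [aN _] := novP a; have [bN _] := novP b.
  rewrite /conv fsbig1// => r _.
  have [r0|r0] := ltP r.1 0; first by rewrite aN// mul0r.
  by rewrite bN ?mulr0//= subr_lt0 (lt_le_trans p0).
have [Sa Ha] := coversP E a; have [Sb Hb] := coversP E b.
apply: (@sub_finite_set _ _ [set` [seq r + s | r <- Sa, s <- Sb]]).
  move=> p [pE] /=; rewrite (conv_seq2 Ha Hb pE) => nz.
  apply/negP => /negP pS; apply: nz.
  rewrite big1_seq// => r /= rS; rewrite big1_seq// => s /= sS.
  case: eqP => // e; case/negP: pS; rewrite -e; exact: allpairs_f.
exact: finite_seq.
Qed.

Definition nov_mul (a b : novikov) := Novikov (conv_novikov a b).

Lemma nov_mulC : commutative nov_mul.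
Proof.
move=> a b; apply: nov_eqP => p /=.
have [Sa Ha] := coversP p.1 a; have [Sb Hb] := coversP p.1 b.
rewrite (conv_seq2 Ha Hb)// (conv_seq2 Hb Ha)// exchange_big/=.
by apply: eq_bigr => s _; apply: eq_bigr => r _; rewrite addrC mulrC.
Qed.

Lemma nov_mulDl : left_distributive nov_mul +%R.
Proof.
move=> a b c; rewrite nov_mulC [nov_mul a c]nov_mulC [nov_mul b c]nov_mulC.
apply: nov_eqP => p; have [Sc Hc] := coversP p.1 c.
rewrite -[RHS]/(conv c a p + conv c b p) -[LHS]/(conv c (a + b) p).
rewrite !(conv_seq _ Hc)// -big_split.
by apply: eq_bigr => r _; rewrite nov_coefD /= mulrDr.
Qed.

Lemma nov_mulA : associative nov_mul.
Proof.
have key (a b c : novikov) Sa Sb Sc p : covers p.1 a Sa -> covers p.1 b Sb ->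
    covers p.1 c Sc -> nov_mul a (nov_mul b c) p =
    \sum_(r <- Sa) \sum_(s <- Sb) \sum_(t <- Sc)
      (if r + s + t == p then a r * b s * c t else 0).
  move=> Ha Hb Hc; rewrite -[LHS]/(conv a (nov_mul b c) p) (conv_seq _ Ha)//.
  apply: eq_bigr => r _ /=; have [aN _] := novP a.
  have [r0|r0] := ltP r.1 0.
    rewrite aN// mul0r big1// => s _; rewrite big1// => t _.
    by rewrite !mul0r if_same.
  rewrite (conv_seq2 Hb Hc)/=; last by rewrite lerBlDr lerDl.
  rewrite mulr_sumr; apply: eq_bigr => s _; rewrite mulr_sumr.
  apply: eq_bigr => t _.
  have -> : (s + t == p - r) = (r + s + t == p).
    by rewrite -addrA [r + _]addrC eq_sym subr_eq eq_sym.
  by case: ifP; rewrite ?mulr0// mulrA.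
move=> a b c; apply: nov_eqP => p.
have [Sa Ha] := coversP p.1 a; have [Sb Hb] := coversP p.1 b.
have [Sc Hc] := coversP p.1 c.
rewrite (key _ _ _ _ _ _ p Ha Hb Hc) nov_mulC (key _ _ _ _ _ _ p Hc Ha Hb).
rewrite [RHS]exchange_big; apply: eq_bigr => r _ /=.
rewrite [RHS]exchange_big; apply: eq_bigr => s _ /=; apply: eq_bigr => t _.
by rewrite -[c t * a r * b s]mulrA [c t * _]mulrC -[t + r + s]addrA
  [t + _]addrC.
Qed.

Definition nov_one_coef p : K := (p == 0)%:R.

Lemma nov_one_novikov : nov_one_coef \in novikov_pred.
Proof.
apply/asboolP; rewrite /nov_one_coef; split=> [p p0|E].
  by case: eqP p0 => // ->; rewrite ltxx.
apply: (@sub_finite_set _ _ [set 0]); last exact: finite_set1.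
by move=> p [_] /=; case: eqP.
Qed.

Definition nov_one := Novikov nov_one_novikov.

Lemma nov_mul1 : left_id nov_one nov_mul.
Proof.
move=> a; apply: nov_eqP => p; rewrite -[LHS]/(conv nov_one a p).
have H : covers (Num.max 0 p.1) nov_one [:: 0].
  split=> // r _; rewrite inE /= /nov_one_coef.
  by case: eqP.
by rewrite (conv_seq _ H) ?le_max ?lexx ?orbT// big_seq1/= /nov_one_coef eqxx
  mul1r subr0.
Qed.

Lemma nov_one_neq0 : nov_one != 0.
Proof.
apply/eqP => /(congr1 (fun a : novikov => a 0)).
rewrite nov_coef0 /= /nov_one_coef eqxx => /eqP; by rewrite oner_eq0.
Qed.

HB.instance Definition _ := GRing.Zmodule_isComNzRing.Build novikov
  nov_mulA nov_mulC nov_mul1 nov_mulDl nov_one_neq0.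

Lemma nov_scaleAl (k : K) (a b : novikov) : k *: (a * b) = k *: a * b.
Proof.
rewrite [a * b]mulrC [_ *: a * b]mulrC.
apply: nov_eqP => p; have [Sb Hb] := coversP p.1 b.
rewrite -[LHS]/(k * conv b a p) -[RHS]/(conv b (k *: a) p).
rewrite !(conv_seq _ Hb)// mulr_sumr; apply: eq_bigr => r _.
by rewrite nov_coefZ mulrCA.
Qed.

HB.instance Definition _ :=
  GRing.Lmodule_isLalgebra.Build K novikov nov_scaleAl.

(* The energy filtration: [a] is divisible by T^E. *)
Definition nov_filt E (a : novikov) : Prop := forall p, p.1 < E -> a p = 0.

End Novikov.

Lemma nov_filtD (R : realType) (K : fieldType) (E : R) (a b : novikov R K) :
  nov_filt E a -> nov_filt E b -> nov_filt E (a + b).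
Proof. by move=> aE bE p pE; rewrite nov_coefD aE// bE// addr0. Qed.

Lemma nov_filtM (R : realType) (K : fieldType) (E : R) (a b : novikov R K) :
  nov_filt E b -> nov_filt E (a * b).
Proof.
move=> bE p pE; rewrite -[LHS]/(conv a b p) /conv fsbig1// => r _.
have [aN _] := novP a; have [r0|r0] := ltP r.1 0; first by rewrite aN// mul0r.
by rewrite bE ?mulr0//= ltrBlDr (lt_le_trans pE)// lerDl.
Qed.

Section CompletedFree.
Variables (R : realType) (K : fieldType).
Local Notation Lam := (novikov R K).

(* The completion, for the energy filtration, of the free module over the
   Novikov ring on the set X: coefficient families tending to 0. *)
Definition decays (X : choiceType) (c : X -> Lam^o) : Prop :=
  forall E : R, finite_set [set x | ~ nov_filt E (c x)].

Definition decays_pred (X : choiceType) : {pred X -> Lam^o} :=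
  fun c => `[< decays c >].

Record cfree (X : choiceType) := CFree {
  cf_coef :> X -> Lam^o;
  cf_coefP : cf_coef \in @decays_pred X }.

HB.instance Definition _ (X : choiceType) := [isSub for @cf_coef X].
HB.instance Definition _ (X : choiceType) := [Choice of cfree X by <:].

Lemma cfP (X : choiceType) (c : cfree X) : decays c.
Proof. exact/asboolP/(valP c). Qed.

Fact decays_submod (X : choiceType) : submod_closed (@decays_pred X).
Proof.
split=> [|k f g /asboolP fE /asboolP gE]; apply/asboolP => E.
  by apply: (sub_finite_set _ (finite_set0 _)) => x; apply.
apply: (@sub_finite_set _ _ ([set x | ~ nov_filt E (f x)] `|`
    [set x | ~ nov_filt E (g x)])); last by rewrite finite_setU.
move=> x /= nfg; apply: contrapT => /not_orP[/contrapT fx /contrapT gx].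
by apply: nfg; apply: nov_filtD => //; apply: nov_filtM.
Qed.

HB.instance Definition _ (X : choiceType) :=
  GRing.isSubmodClosed.Build Lam (X -> Lam^o) (@decays_pred X)
    (@decays_submod X).
HB.instance Definition _ (X : choiceType) :=
  [SubChoice_isSubLmodule of cfree X by <:].

Lemma cf_supp_finite (X : choiceType) (c : X -> Lam^o) (S : seq X) :
  (forall x, x \notin S -> c x = 0) -> c \in @decays_pred X.
Proof.
move=> cS; apply/asboolP => E; apply: (@sub_finite_set _ _ [set` S]).
  by move=> x /= cx; apply/negP => /negP /cS c0; apply: cx; rewrite c0.
exact: finite_seq.
Qed.

(* The convergent sum of c x * f x over all x in X. *)
Definition cint_coef (X : choiceType) (f : X -> Lam) (c : X -> Lam^o)
    (p : R * int) : K^o :=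
  \sum_(x \in [set: X]) ((c x : Lam) * f x) p.

Lemma cint_coefP (X : choiceType) (f : X -> Lam) (c : cfree X) :
  cint_coef f c \in @novikov_pred R K.
Proof.
apply/asboolP; split=> [p p0|E].
  rewrite /cint_coef fsbig1// => x _.
  by have [-> //] := novP (((c x) : Lam) * f x).
pose B := [set x | ~ nov_filt (E + 1) (c x)].
apply: (@sub_finite_set _ _ (\bigcup_(x in B)
    [set p | p.1 <= E /\ ((c x : Lam) * f x) p <> 0])).
  move=> p [pE np]; apply: contrapT => nB; apply: np.
  rewrite /cint_coef fsbig1// => x _; apply: contrapT => nx; apply: nB.
  exists x => //= fx; apply: nx; rewrite [(_ : Lam) * _]mulrC.
  by rewrite (nov_filtM _ fx)// (le_lt_trans pE)// ltrDl.
apply: bigcup_finite; first exact: cfP.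
by move=> x _; have [_] := novP ((c x : Lam) * f x); apply.
Qed.

(* The continuous linear extension of f to the completed free module. *)
Definition cint (X : choiceType) (f : X -> Lam) (c : cfree X) : Lam :=
  Novikov (cint_coefP f c).

Lemma nov_filt_cint (X : choiceType) (f : X -> Lam) (c : cfree X) (E : R) :
  (forall x, nov_filt E ((c x : Lam) * f x)) -> nov_filt E (cint f c).
Proof. by move=> cf p pE; rewrite /= /cint_coef fsbig1// => x _; exact: cf. Qed.

Lemma cext_coefP (X Y : choiceType) (f : X -> cfree Y) (c : cfree X) :
  (fun y => cint (fun x => f x y) c) \in @decays_pred Y.
Proof.
apply/asboolP => E; pose B := [set x | ~ nov_filt E (c x)].
apply: (@sub_finite_set _ _ (\bigcup_(x in B) [set y | ~ nov_filt E (f x y)])).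
  move=> y /= ny; apply: contrapT => nB; apply: ny; apply: nov_filt_cint => x.
  have [cx|cx] := EM (nov_filt E (c x)).
    by rewrite mulrC; apply: nov_filtM.
  by apply: nov_filtM; apply: contrapT => fx; apply: nB; exists x.
by apply: bigcup_finite => [|x _]; exact: cfP.
Qed.

Definition cext (X Y : choiceType) (f : X -> cfree Y) (c : cfree X) : cfree Y :=
  CFree (cext_coefP f c).

End CompletedFree.

Section Combinatorics.
Variable T : Type.

(* All decompositions of s into consecutive nonempty blocks. *)
Fixpoint decomps (s : seq T) : seq (seq (seq T)) :=
  if s is x :: s' then
    flatten [seq (if d is b :: d' then [:: [:: x] :: d; (x :: b) :: d']
                  else [:: [:: [:: x]]]) | d <- decomps s']
  else [:: [::]].

End Combinatorics.

Lemma mem_decomps (T : eqType) (s : seq T) d :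
  (d \in decomps s) = (flatten d == s) && ([::] \notin d).
Proof.
elim: s d => [|x s IH] d /=.
  rewrite inE; case: d => [|[|y b] d] //=; rewrite ?inE ?eqxx ?andbF//.
apply/flatten_mapP/andP => [[d0]|].
  rewrite IH => /andP[/eqP fd nd]; case: d0 fd nd => [|b d0] /= fd nd.
    by rewrite inE => /eqP ->; rewrite /= -fd.
  rewrite !inE => /orP[] /eqP -> /=; first by rewrite fd eqxx inE.
  rewrite fd eqxx; split=> //; rewrite inE negb_or /=.
  by move: nd; rewrite inE negb_or => /andP[].
case: d => [|[|y b] d] //=.
- by case.
- by case.
case=> /eqP[-> sE]; rewrite inE /= => nd.
case: b sE => [|z b] /= sE.
  exists d; first by rewrite IH sE eqxx.
  by case: d nd {sE} => [|c d] nd; rewrite !inE eqxx.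
exists ((z :: b) :: d); first by rewrite IH /= sE eqxx inE.
by rewrite !inE eqxx orbT.
Qed.

Lemma uniq_decomps (T : eqType) (s : seq T) : uniq (decomps s).
Proof.
elim: s => //= x s IH; set F := (F in map F _).
pose G (d : seq (seq T)) := if d is (y :: b) :: d' then
  (if b is [::] then d' else b :: d') else [::].
have GF d : [::] \notin d -> all (fun e => G e == d) (F d) && uniq (F d).
  case: d => [|[|y b] d] //= _; rewrite !eqxx /= !andbT inE.
  by apply/negP => /eqP[].
have : all (fun d => [::] \notin d) (decomps s).
  by apply/allP => d; rewrite mem_decomps => /andP[].
elim: (decomps s) IH => //= d D IHD /andP[dD uD] /andP[nd nD].
have /andP[/allP Gd ud] := GF _ nd.
rewrite cat_uniq ud IHD// andbT; apply/hasPn => e /flatten_mapP[d1 d1D ed1].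
apply/negP => /Gd /eqP Ge.
have /andP[/allP/(_ _ ed1)/eqP Ge1 _] := GF _ (allP nD _ d1D).
by move: dD; rewrite -Ge Ge1 d1D.
Qed.

Definition multilinear (S : pzRingType) (U W : lmodType S) (f : seq U -> W) :=
  forall (s t : seq U) (a : S) (x y : U),
    f (s ++ (a *: x + y) :: t) = a *: f (s ++ x :: t) + f (s ++ y :: t).

Definition ksign (S : pzRingType) (d : int) : S := (-1) ^+ `|d|%N.

Section GradedSpace.
Variable K : fieldType.

Record gradedSpace := GradedSpace {
  gr_space :> vectType K;
  gr : int -> {vspace gr_space};
  gr_degs : seq int;
  gr_degs_uniq : uniq gr_degs;
  gr_degs_supp : forall d, d \notin gr_degs -> gr d = 0%VS;
  gr_direct : directv (\sum_(i < size gr_degs) gr gr_degs`_i);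
  gr_full : (\sum_(i < size gr_degs) gr gr_degs`_i)%VS = fullv }.

Variable V : gradedSpace.

(* A homogeneous basis of V and the list of the degrees of its elements. *)
Definition hbasis : seq V :=
  \big[cat/[::]]_(i < size (gr_degs V)) vbasis (gr V (gr_degs V)`_i).

Definition hdegs : seq int :=
  \big[cat/[::]]_(i < size (gr_degs V))
    nseq (\dim (gr V (gr_degs V)`_i)) (gr_degs V)`_i.

Lemma hbasisP : basis_of fullv hbasis.
Proof.
rewrite -(gr_full V); apply: bigcat_basis; first exact: gr_direct.
by move=> i _; exact: vbasisP.
Qed.

Lemma hbasis_deg i : (i < size hbasis)%N -> hbasis`_i \in gr V hdegs`_i.
Proof.
have aux (s : seq V) (t : seq int) :
    all2 (fun v d => v \in gr V d) s t ->
    forall i, (i < size s)%N -> s`_i \in gr V t`_i.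
  elim: s t => [|v s IH] [|d t]//= /andP[vd /IH st] [|j]//=; exact: st.
apply: aux; rewrite /hbasis /hdegs.
elim/big_ind2: _ => // [s1 t1 s2 t2|j _].
  by elim: s1 t1 => [|v s1 IH] [|d t1]//= /andP[-> /IH h] /h.
set U := gr V _.
have: {subset tval (vbasis U) <= U} by move=> v; exact: vbasis_mem.
have := size_tuple (vbasis U); move: (tval (vbasis U)) => s.
elim: s (\dim U) => [|v s IH] [|n]//= [sn] sU.
by rewrite sU ?mem_head//=; apply: IH => // w ws; rewrite sU// inE ws orbT.
Qed.

Definition bidx : finType := 'I_(size hbasis).
Definition bvec (i : bidx) : V := hbasis`_i.
Definition bcoord (i : bidx) (v : V) : K := coord (in_tuple hbasis) i v.

(* The degree of a basis vector in the shifted space V[1]. *)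
Definition sdeg (i : bidx) : int := hdegs`_i - 1.

End GradedSpace.

Section Tensors.
Variables (R : realType) (K : fieldType) (V : gradedSpace K).
Local Notation Lam := (novikov R K).

(* The tensor product of V with the Novikov ring: the free module on the
   homogeneous basis of V. *)
Definition nov_ext : lmodType Lam := {ffun bidx V -> Lam^o}.

Implicit Types (x : nov_ext) (xs : seq nov_ext) (i : bidx V) (w : seq (bidx V)).

Definition ncoord x i : Lam := (x : {ffun bidx V -> Lam^o}) i.

Definition nvec i : nov_ext := [ffun j => (j == i)%:R].

Definition ext_filt (E : R) x : Prop := forall i, nov_filt E (ncoord x i).

(* x is homogeneous of degree d in the shifted space; T has degree 0 and e
   has degree 2. *)
Definition ext_shomog (d : int) x : Prop :=
  forall i (p : R * int), ncoord x i p <> 0 -> sdeg i + p.2 * 2 = d.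

(* Words in the basis index the basis of the (completed) tensor coalgebra;
   pairs of a letter (the underlined module factor) and a word index the basis
   of the Hochschild chains.  Maps out of them are given on basis words and
   extended linearly and continuously, so that an equation between two of them
   amounts to the equation on tensors of basis vectors. *)
Definition tcoalg := cfree R K (seq (bidx V)).
Definition hchain := cfree R K (bidx V * seq (bidx V))%type.

Definition tens_coef xs w : Lam :=
  if size w == size xs then \prod_(u <- zip xs w) ncoord u.1 u.2 else 0.

Lemma tens_coefP xs : (tens_coef xs : _ -> Lam^o) \in @decays_pred R K _.
Proof.
pose S := [seq tval t | t <- enum {: (size xs).-tuple (bidx V)}].
apply: (@cf_supp_finite _ _ _ _ S) => w; rewrite /tens_coef.
case: eqP => // ws; case/negP; apply/mapP; rewrite -ws.
by exists (in_tuple w); rewrite // mem_enum.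
Qed.

(* The pure tensor of a list of elements. *)
Definition tens xs : tcoalg := CFree (tens_coefP xs).

Definition htens_coef x xs (u : bidx V * seq (bidx V)) : Lam :=
  ncoord x u.1 * tens_coef xs u.2.

Lemma htens_coefP x xs :
  (htens_coef x xs : _ -> Lam^o) \in @decays_pred R K _.
Proof.
pose S := [seq tval t | t <- enum {: (size xs).-tuple (bidx V)}].
apply: (@cf_supp_finite _ _ _ _ [seq (i, w) | i <- enum (bidx V), w <- S]).
move=> [i w] iw; rewrite /htens_coef /tens_coef /=.
case: eqP => [ws|]; last by rewrite mulr0.
case/negP: iw; apply: allpairs_f; first by rewrite mem_enum.
by apply/mapP; rewrite -ws; exists (in_tuple w); rewrite // mem_enum.
Qed.

(* The pure tensor with first factor x, as a Hochschild chain. *)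
Definition htens x xs : hchain := CFree (htens_coefP x xs).

(* The multilinear map with prescribed values on basis words. *)
Definition mlext (W : lmodType Lam) (f : seq (bidx V) -> W) xs : W :=
  \sum_(w : (size xs).-tuple (bidx V)) tens_coef xs w *: f w.

Definition wdeg w : int := \sum_(i <- w) sdeg i.

Lemma tens_nvec w v : tens (map nvec w) v = (v == w)%:R.
Proof.
rewrite /= /tens_coef size_map; case: (size v =P size w) => [|vw]; last first.
  by case: eqP => // e; case: vw; rewrite e.
elim: v w => [|i v IH] [|j w] //= => [_|[/IH e]]; first by rewrite big_nil.
rewrite big_cons e /= /ncoord ffunE eqseq_cons.
by case: eqP => _; rewrite ?mul1r ?mul0r.
Qed.

Lemma cext_tens (Y : choiceType) (f : seq (bidx V) -> cfree R K Y) w :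
  cext f (tens (map nvec w)) = f w.
Proof.
apply: val_inj; apply/funext => y; apply: nov_eqP => p /=.
have nz v : v != w -> tens (map nvec w) v = 0.
  by rewrite tens_nvec => /negbTE ->.
rewrite /cint_coef (fsbigE [:: w])//=; last first.
  move=> v _; rewrite inE => /nz /= ->.
  by rewrite -[LHS]/((0 * f v y : Lam) p) mul0r.
rewrite big_mkcond/= big_seq1 in_setT -[tens_coef _ w]/(tens (map nvec w) w).
by rewrite tens_nvec eqxx -[LHS]/((1 * f w y : Lam) p) mul1r.
Qed.

Lemma mlext_nvec (W : lmodType Lam) (f : seq (bidx V) -> W) w :
  mlext f (map nvec w) = f w.
Proof.
have sw : size w == size (map nvec w) by rewrite size_map.
rewrite /mlext (bigD1 (Tuple sw))//= big1 => [|v vw].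
  by rewrite -[tens_coef _ _]/(tens (map nvec w) w) tens_nvec eqxx scale1r addr0.
rewrite -[tens_coef _ _]/(tens (map nvec w) v) tens_nvec.
by have /negbTE -> : tval v != w by []; rewrite scale0r.
Qed.

End Tensors.

Section Ainfty.
Variables (R : realType) (K : fieldType).
Local Notation Lam := (novikov R K).

(* Discreteness of the energies means finiteness below every bound; it is what
   makes the sum defining m_k have coefficients in the Novikov ring. *)
Record gapMonoid := GapMonoid {
  gap_set : set (R * int);
  gap_ge0 : forall b, gap_set b -> 0 <= b.1;
  gap_even : forall b, gap_set b -> (2 %| b.2)%Z;
  gap_0 : gap_set 0;
  gap_D : forall b c, gap_set b -> gap_set c -> gap_set (b + c);
  gap_discrete : forall E : R,
    finite_set [set l | l <= E /\ exists mu, gap_set (l, mu)];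
  gap_energy0 : forall mu, gap_set (0, mu) -> mu = 0;
  gap_finite : forall l, finite_set [set mu | gap_set (l, mu)] }.

(* [ops b] restricted to lists of length k is m_{k,b}; the values of [ops]
   outside G are irrelevant. *)
Record ainfData := AinfData {
  ai_space :> gradedSpace K;
  ai_gap : gapMonoid;
  ai_ops : R * int -> seq ai_space -> ai_space }.

Section Operations.
Variable A : ainfData.
Local Notation G := (gap_set (ai_gap A)).
Local Notation AL := (nov_ext R A).
Implicit Types (w : seq (bidx A)) (xs : seq AL).

(* The coordinate i of the sum over b = (l, mu) in G of
   T^l e^(mu / 2) m_b(w): the coefficient of T^l e^q comes from b = (l, 2q). *)
Definition m_coef w (i : bidx A) (p : R * int) : K^o :=
  if `[< G (p.1, p.2 * 2) >] then
    bcoord i (ai_ops (p.1, p.2 * 2) (map (@bvec K A) w)) else 0.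

Lemma m_coefP w i : m_coef w i \in @novikov_pred R K.
Proof.
apply/asboolP; rewrite /m_coef; split=> [p p0|E].
  case: asboolP => // /gap_ge0 /= h; by move: p0; rewrite ltNge h.
pose L := [set l | l <= E /\ exists mu, G (l, mu)].
pose g (b : R * int) := (b.1, (b.2 %/ 2)%Z).
apply: (@sub_finite_set _ _
    (g @` (\bigcup_(l in L) (pair l @` [set mu | G (l, mu)])))).
  move=> [l q] /= [lE]; case: asboolP => // Gp _.
  exists (l, q * 2); last by rewrite /g /= mulzK.
  exists l; first by split=> //; exists (q * 2).
  by exists (q * 2).
apply: finite_image; apply: bigcup_finite; first exact: gap_discrete.
by move=> l _; apply: finite_image; apply: gap_finite.
Qed.

Definition m_word w : AL := [ffun i => Novikov (m_coefP w i) : Lam^o].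

Definition m xs : AL := mlext m_word xs.

Definition mhat_word (k : nat) w : tcoalg R A :=
  if (k <= size w)%N then
    \sum_(i < (size w - k).+1) ksign Lam (wdeg (take i w)) *:
      tens (map (@nvec R K A) (take i w)
            ++ m (map (@nvec R K A) (take k (drop i w)))
            :: map (@nvec R K A) (drop (i + k) w))
  else 0.

(* mhat_k vanishes on words of length < k. *)
Definition dhat : tcoalg R A -> tcoalg R A :=
  cext (fun w => \sum_(k < (size w).+1) mhat_word k w).

End Operations.

Record is_ainf (A : ainfData) : Prop := IsAinf {
  ai_multilinear : forall b, gap_set (ai_gap A) b -> multilinear (@ai_ops A b);
  ai_m00 : @ai_ops A 0 [::] = 0;
  ai_degree : forall (ds : seq int) (xs : seq (nov_ext R A)),
    size ds = size xs ->
    (forall j, (j < size xs)%N -> ext_shomog ds`_j xs`_j) ->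
    ext_shomog ((\sum_(d <- ds) d) + 1) (m xs);
  ai_eq : forall t : tcoalg R A, dhat (dhat t) = 0 }.

Record cyclicAinf := CyclicAinf {
  ca_ainf :> ainfData;
  ca_axioms : is_ainf ca_ainf;
  ca_pair : {biscalar ca_ainf};
  ca_nondeg : forall x, (forall y, ca_pair x y = 0) -> x = 0;
  ca_skew : forall (c d : int) (x y : ca_ainf), x \in gr _ c -> y \in gr _ d ->
    ca_pair x y = - (ksign K ((c - 1) * (d - 1)) * ca_pair y x);
  (* x, xs is the list x_1, x_2, ..., x_{k+1}. *)
  ca_cyclic : forall b, gap_set (ai_gap ca_ainf) b ->
    forall (d : int) (x : ca_ainf) (ds : seq int) (xs : seq ca_ainf),
    x \in gr _ d -> all2 (fun y c => y \in gr _ c) xs ds ->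
    ca_pair (ai_ops b (belast x xs)) (last x xs) =
      ksign K ((d - 1) * \sum_(c <- ds) (c - 1)) * ca_pair (ai_ops b xs) x }.

Definition pairing (A : cyclicAinf) (x y : nov_ext R A) : Lam :=
  \sum_i \sum_j ca_pair A (bvec i) (bvec j) *: (ncoord x i * ncoord y j).

(* m^+ on the tensor x_1, ..., x_k, given as a head and a tail. *)
Definition mplus_seq (A : cyclicAinf) (x : nov_ext R A) xs : Lam :=
  pairing (m (belast x xs)) (last x xs).

Definition mplus (A : cyclicAinf) : hchain R A -> Lam :=
  cint (fun u => mplus_seq (nvec R u.1) (map (@nvec R K A) u.2)).

Section Homomorphisms.
Variables A B : ainfData.
Local Notation AL := (nov_ext R A).
Local Notation BL := (nov_ext R B).
Variable h : seq AL -> BL.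

Definition coh : tcoalg R A -> tcoalg R B :=
  cext (fun w => \sum_(d <- decomps (map (@nvec R K A) w)) tens (map h d)).

Definition hhat_word (u : bidx A * seq (bidx A)) : hchain R B :=
  let (x0, w) := u in let k := size w in
  \sum_(i < k.+1) \sum_(j < (k - i).+1)
    \sum_(d <- decomps (map (@nvec R K A) (take (k - i - j) (drop j w))))
      ksign Lam (wdeg (drop (k - i) w) * wdeg (x0 :: take (k - i) w)) *:
        htens (h (map (@nvec R K A) (drop (k - i) w ++ x0 :: take j w)))
              (map h d).

Definition hhat : hchain R A -> hchain R B := cext hhat_word.

(* [h] restricted to lists of length k >= 1 is h_k; [h [::]] is irrelevant. *)
Record is_ainf_hom : Prop := IsAinfHom {
  ah_multilinear : multilinear h;
  ah_filt : forall (Es : seq R) (xs : seq AL), xs != [::] ->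
    size Es = size xs -> all (fun E => 0 <= E) Es ->
    (forall j, (j < size xs)%N -> ext_filt Es`_j xs`_j) ->
    ext_filt (\sum_(E <- Es) E) (h xs);
  ah_degree : forall (ds : seq int) (xs : seq AL), xs != [::] ->
    size ds = size xs ->
    (forall j, (j < size xs)%N -> ext_shomog ds`_j xs`_j) ->
    ext_shomog (\sum_(d <- ds) d) (h xs);
  ah_comm : forall t : tcoalg R A, coh (dhat t) = dhat (coh t) }.

End Homomorphisms.

Record is_cyclic_hom (A B : cyclicAinf)
    (h : seq (nov_ext R A) -> nov_ext R B) : Prop := IsCyclicHom {
  ch_hom : is_ainf_hom h;
  ch_iso : forall x y, pairing (h [:: x]) (h [:: y]) = pairing x y;
  ch_cyclic : forall xs, (3 <= size xs)%N ->
    \sum_(1 <= i < size xs) pairing (h (take i xs)) (h (drop i xs)) = 0 }.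

End Ainfty.

(* Main.v *)
(** Read a Hochschild chain as a cyclic word.  Cyclicity of m_B rotates every
    term of m_B^+ (hhat (x_0, ..., x_k)) into the form <m_B (h P), h Q>, where
    the cyclic word is cut into P and Q and x_k lies in Q.  Summed over the
    block decompositions of P, the A_infinity relation for h replaces m_B (h P)
    by the sum of the h (P1, m_A I, P2) with P = P1 I P2.  For a fixed interval
    I, what remains is the sum, over all ways to cut the cyclic word formed by
    m_A I and the other letters into two blocks separating m_A I from x_k, of
    the pairing of the images of the blocks under h.  As a function of the two
    cuts this pairing is antisymmetric, and its sum over one cut vanishes by the
    cyclicity of h as soon as there are at least three letters, so the sum is 0.
    Only I = (x_0, ..., x_{k-1}) leaves two letters, and it contributes
    <h_1 (m_A I), h_1 x_k> = <m_A I, x_k>. *)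
Require Import Defs.
From HB Require Import structures.
From mathcomp Require Import all_boot all_order all_algebra.
From mathcomp Require Import finmap.
From mathcomp Require Import boolp classical_sets cardinality fsbigop.
From mathcomp Require Import reals.
From mathcomp Require Import zify ring.
Set Implicit Arguments.
Unset Strict Implicit.
Unset Printing Implicit Defensive.
Import Order.TTheory GRing.Theory Num.Theory.
Local Open Scope ring_scope.

Lemma odd_abszD (d e : int) : odd `|(d + e)%R|%N = odd `|d|%N (+) odd `|e|%N.
Proof. lia. Qed.

Lemma ksignE (S : pzRingType) (d : int) : ksign S d = (-1) ^+ odd `|d|%N.
Proof. by rewrite signr_odd. Qed.

(** These rules turn a Koszul sign into a boolean expression in the parities of the degrees, so that
    sign identities can be checked by cases. *)
Definition parityE := (ksignE, abszM, oddM, odd_abszD).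

(** * Convergent sums *)

Section CompletedFree.
Variables (R : realType) (K : fieldType).
Local Notation Lam := (novikov R K).

Lemma nov_filt_sum (I : eqType) (r : seq I) (F : I -> Lam) (E : R) :
  (forall i, i \in r -> nov_filt E (F i)) -> nov_filt E (\sum_(i <- r) F i).
Proof.
move=> FE; rewrite big_seq; elim/big_rec: _ => [p _ //|i x ir xE].
by apply: nov_filtD => //; apply: FE.
Qed.

Lemma nov_filtB (a b : Lam) E :
  nov_filt E a -> nov_filt E b -> nov_filt E (a - b).
Proof. by move=> aE bE p pE; rewrite nov_coefD nov_coefN aE ?bE ?subr0. Qed.

(** The energy filtration is separated, so convergent sums may be compared modulo every T^E, where
    they become finite. *)
Lemma nov_filt_eq (a b : Lam) : (forall E, nov_filt E (a - b)) -> a = b.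
Proof.
move=> ab; apply/eqP; rewrite -subr_eq0; apply/eqP/nov_eqP => p.
by rewrite (ab (p.1 + 1)) ?ltrDl.
Qed.

Lemma nov_coef_sum (I : Type) (r : seq I) (P : pred I) (F : I -> Lam) p :
  (\sum_(i <- r | P i) F i) p = \sum_(i <- r | P i) F i p.
Proof. by elim/big_rec2: _ => // i x y _ <-. Qed.

Definition ccovers (X : choiceType) E (c : cfree R K X) (S : seq X) :=
  uniq S /\ forall x, x \notin S -> nov_filt E (c x).

(** A common support modulo T^E lets several convergent sums be truncated to finite sums over one
    index set. *)
Lemma ccoversP (X : choiceType) E (cs : seq (cfree R K X)) :
  exists S : seq X, uniq S /\ forall c, c \in cs -> ccovers E c S.
Proof.
elim: cs => [|c cs [S [uS cS]]]; first by exists [::].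
pose B := fset_set [set x | ~ nov_filt E (c x)]%classic.
exists (undup (enum_fset B ++ S)); split; first exact: undup_uniq.
move=> c'; rewrite inE => /orP[/eqP ->|/cS [_ c'S]];
  (split; first exact: undup_uniq) => x;
  rewrite mem_undup mem_cat negb_or => /andP[xB xS]; last exact: c'S.
apply: contrapT => cx; case/negP: xB.
by rewrite in_fset_set ?inE //; apply: cfP.
Qed.

Lemma cint_ccovers (X : choiceType) E (g : X -> Lam) (c : cfree R K X) S :
  ccovers E c S -> nov_filt E (cint g c - \sum_(x <- S) (c x : Lam) * g x).
Proof.
move=> [uS cS] p pE; rewrite nov_coefD nov_coefN nov_coef_sum /= /cint_coef.
rewrite (fsbigE S) //=.
  by rewrite (eq_bigl _ _ (in_setT)) subrr.
move=> x _ /cS cx; rewrite -[LHS]/(((c x : Lam) * g x) p) mulrC.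
exact: nov_filtM pE.
Qed.

Lemma cint_linear (X : choiceType) (g : X -> Lam) :
  linear (cint g : cfree R K X -> Lam^o).
Proof.
move=> a c d; apply: nov_filt_eq => E.
have [S [_ S_]] := ccoversP E [:: c; d; a *: c + d].
have /(cint_ccovers g) Hc : ccovers E c S by apply: S_; rewrite !inE eqxx.
have /(cint_ccovers g) Hd : ccovers E d S by apply: S_; rewrite !inE eqxx orbT.
have /(cint_ccovers g) He : ccovers E (a *: c + d) S.
  by apply: S_; rewrite !inE eqxx !orbT.
set x := cint g _ in He *; set y := \sum_(i <- _) _ in Hc.
set z := \sum_(i <- _) _ in Hd; set w := \sum_(i <- _) _ in He.
have -> : x - (a *: (cint g c : Lam^o) + cint g d) =
    (x - w) - (a * (cint g c - y) + (cint g d - z)).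
  have -> : w = a * y + z.
    rewrite mulr_sumr -big_split /=; apply: eq_bigr => i _.
    by rewrite -[cf_coef _ i]/(a * (c i : Lam) + d i) mulrDl mulrA.
  by rewrite -[a *: _]/(a * cint g c) mulrBr; ring.
apply: nov_filtB => //; apply: nov_filtD => //; exact: nov_filtM.
Qed.

HB.instance Definition _ (X : choiceType) (g : X -> Lam) :=
  GRing.isLinear.Build Lam (cfree R K X) Lam^o _ (cint g) (cint_linear g).

Lemma cint_finite (X : choiceType) (g : X -> Lam) (c : cfree R K X)
    (S : seq X) :
  uniq S -> (forall x, x \notin S -> c x = 0) ->
  cint g c = \sum_(x <- S) (c x : Lam) * g x.
Proof.
move=> uS cS; apply: nov_filt_eq => E; apply: cint_ccovers; split=> // x xS.
by rewrite cS.
Qed.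

(** A Fubini rule: modulo T^E both sides are finite double sums over S and T, which may be
    exchanged. *)
Lemma cint_cext (X Y : choiceType) (g : Y -> Lam) (f : X -> cfree R K Y)
    (c : cfree R K X) :
  cint g (cext f c) = cint (fun x => cint g (f x)) c.
Proof.
apply: nov_filt_eq => E.
have [S [_ /(_ c (mem_head _ _)) Sc]] := ccoversP E [:: c].
have [T [_ T_]] := ccoversP E (cext f c :: [seq f x | x <- S]).
have := cint_ccovers g (T_ _ (mem_head _ _)).
have := cint_ccovers (fun x => cint g (f x)) Sc.
set a := \sum_(i <- S) _; set b := \sum_(i <- T) _ => Ha Hb.
rewrite -[_ - _](subrKA b) -[b - _](subrKA a).
rewrite -[a - _]opprB [b - a - _]addrC addrA.
(* The exact double sums over S and T cancel, so only truncation errors remain, and each lies in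
   filtration E. *)
have -> : b - a =
    \sum_(y <- T) g y * (cext f c y - \sum_(x <- S) (c x : Lam) * f x y)
  - \sum_(x <- S) (c x : Lam) *
      (cint g (f x) - \sum_(y <- T) (f x y : Lam) * g y).
  apply/eqP; rewrite -subr_eq0; apply/eqP.
  under [X in _ - (X - _)]eq_bigr do rewrite mulrBr mulrC mulr_sumr.
  under [X in _ - (_ - X)]eq_bigr do rewrite mulrBr mulr_sumr.
  rewrite !sumrB exchange_big /=.
  set u := \sum_(j <- S) _; set v := \sum_(i <- S) \sum_(j <- T) _.
  have -> : u = v.
    apply: eq_bigr => x _; apply: eq_bigr => y _; ring.
  by rewrite -/a -/b; ring.
apply: nov_filtD; first exact: nov_filtB.
apply: nov_filtB; apply: nov_filt_sum => x xS; apply: nov_filtM.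
  exact: (cint_ccovers (fun x0 => f x0 x) Sc).
by apply: cint_ccovers; apply: T_; rewrite inE map_f ?orbT.
Qed.

Lemma cf_coef_sum (X : choiceType) (I : Type) (r : seq I) (P : pred I)
    (F : I -> cfree R K X) x :
  (\sum_(i <- r | P i) F i) x = \sum_(i <- r | P i) F i x.
Proof. by elim/big_rec2: _ => // i y z _ <-. Qed.

End CompletedFree.

(** * Multilinear maps and tensors *)

Section Multilinear.
Variables (S : pzRingType) (U W : lmodType S) (f : seq U -> W).
Hypothesis f_ml : multilinear f.

Lemma multilinear0 s t : f (s ++ 0 :: t) = 0.
Proof.
apply: (addrI (f (s ++ 0 :: t))); rewrite addr0 -[X in X + _]scale1r -f_ml.
by rewrite scale1r addr0.
Qed.

Lemma multilinear_sum (I : Type) (r : seq I) (a : I -> S) (x : I -> U) s t :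
  f (s ++ (\sum_(i <- r) a i *: x i) :: t) =
  \sum_(i <- r) a i *: f (s ++ x i :: t).
Proof.
elim: r => [|i r IH]; first by rewrite !big_nil multilinear0.
by rewrite !big_cons f_ml IH.
Qed.

End Multilinear.

Lemma big_tuple_cons (T : finType) (V : nmodType) n (F : seq T -> V) :
  \sum_(t : n.+1.-tuple T) F t = \sum_i \sum_(t : n.-tuple T) F (i :: t).
Proof.
rewrite pair_big /=.
rewrite (reindex (fun p : T * n.-tuple T => [tuple of p.1 :: p.2])) //=.
exists (fun t => (thead t, [tuple of behead t])) => [[i t]|t] _ /=.
  by congr pair; apply: val_inj.
by apply: val_inj; rewrite /= [in RHS](tuple_eta t).
Qed.

Section Tensors.
Variables (R : realType) (K : fieldType) (V : gradedSpace K).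
Local Notation Lam := (novikov R K).
Local Notation VL := (nov_ext R V).
Implicit Types (x : VL) (xs : seq VL) (w : seq (bidx V)).
Implicit Types zs : seq (int * VL).

Lemma ncoordD x y i : ncoord (x + y) i = ncoord x i + ncoord y i.
Proof. by rewrite /ncoord ffunE. Qed.

Lemma ncoordZ (a : Lam) x i : ncoord (a *: x) i = a * ncoord x i.
Proof. by rewrite /ncoord ffunE. Qed.

Lemma ncoord_sum (I : Type) (r : seq I) (P : pred I) (F : I -> VL) i :
  ncoord (\sum_(j <- r | P j) F j) i = \sum_(j <- r | P j) ncoord (F j) i.
Proof.
by elim/big_rec2: _ => [|j y z _ <-]; rewrite ?ncoordD // /ncoord ffunE.
Qed.

Lemma ncoord_nvec i j : ncoord (@nvec R K V i) j = (j == i)%:R.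
Proof. by rewrite /ncoord ffunE. Qed.

Lemma nov_extP x y : (forall i, ncoord x i = ncoord y i) -> x = y.
Proof. by move=> xy; apply/ffunP. Qed.

Lemma nvec_sum x : x = \sum_i ncoord x i *: nvec R i.
Proof.
apply: nov_extP => i; rewrite ncoord_sum (bigD1 i) //= ncoordZ ncoord_nvec eqxx.
rewrite mulr1 big1 ?addr0 // => j ji.
by rewrite ncoordZ ncoord_nvec eq_sym (negbTE ji) mulr0.
Qed.

Lemma tens_coef_cons x xs i w :
  tens_coef (x :: xs) (i :: w) = ncoord x i * tens_coef xs w.
Proof.
by rewrite /tens_coef /= eqSS; case: eqP => _; rewrite ?mulr0 // big_cons.
Qed.

Lemma mlext_nil (W : lmodType Lam) (f : seq (bidx V) -> W) :
  mlext f [::] = f [::].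
Proof. exact: (mlext_nvec f [::]). Qed.

Lemma mlext_cons (W : lmodType Lam) (f : seq (bidx V) -> W) x xs :
  mlext f (x :: xs) = \sum_i ncoord x i *: mlext (fun w => f (i :: w)) xs.
Proof.
rewrite /mlext (big_tuple_cons _ (fun w => tens_coef (x :: xs) w *: f w)).
apply: eq_bigr => i _; rewrite scaler_sumr; apply: eq_bigr => w _.
by rewrite tens_coef_cons scalerA.
Qed.

Lemma multilinear_mlext (W : lmodType Lam) (f : seq (bidx V) -> W) :
  multilinear (mlext f : seq VL -> W).
Proof.
move=> s t a x y; elim: s f => [|z s IH] f /=; rewrite !mlext_cons scaler_sumr.
  rewrite -big_split; apply: eq_bigr => i _ /=.
  by rewrite ncoordD ncoordZ scalerDl scalerA.
rewrite -big_split; apply: eq_bigr => i _ /=.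
by rewrite IH scalerDr !scalerA mulrC.
Qed.

(** Expanding the first argument in the basis and freezing it leaves a multilinear map of the
    others. Identities of multilinear maps thus reduce to basis words. *)
Lemma mlext_multilinear (W : lmodType Lam) (f : seq VL -> W) xs :
  multilinear f -> mlext (fun w => f (map (@nvec R K V) w)) xs = f xs.
Proof.
elim: xs f => [|x xs IH] f f_ml; first by rewrite mlext_nil.
rewrite mlext_cons [in RHS](nvec_sum x).
rewrite (multilinear_sum f_ml _ _ _ [::]); apply: eq_bigr => i _.
congr (_ *: _); apply: (IH (fun l => f (nvec R i :: l))) => s t.
exact: (f_ml (nvec R i :: s)).
Qed.

(** Words with nonzero coefficient have the length of [xs] and, for homogeneous entries, the right
    parity; this is how both facts enter later. *)
Lemma eq_mlext (W : lmodType Lam) (f g : seq (bidx V) -> W) xs :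
  (forall w, tens_coef xs w != 0 -> f w = g w) -> mlext f xs = mlext g xs.
Proof.
move=> fg; apply: eq_bigr => w _.
by have [->|/fg ->] := eqVneq (tens_coef xs w) 0; rewrite ?scale0r.
Qed.

Lemma cint_tens (g : seq (bidx V) -> Lam) xs :
  cint g (tens xs) = mlext (g : _ -> Lam^o) xs.
Proof.
pose S := [seq tval t | t <- enum {: (size xs).-tuple (bidx V)}].
rewrite (@cint_finite _ _ _ _ _ S) /=.
- by rewrite big_map big_enum.
- by rewrite map_inj_uniq ?enum_uniq //; apply: val_inj.
move=> w; rewrite /tens_coef; case: eqP => // ws; case/negP; apply/mapP.
by rewrite -ws; exists (in_tuple w); rewrite // mem_enum.
Qed.

Lemma cint_htens (g : seq VL -> Lam) x xs : multilinear (g : _ -> Lam^o) ->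
  cint (fun u : bidx V * seq (bidx V) => g (map (@nvec R K V) (u.1 :: u.2)))
    (htens x xs) = g (x :: xs).
Proof.
move=> g_ml; rewrite -(mlext_multilinear (x :: xs) g_ml).
pose S := [seq tval t | t <- enum {: (size xs).-tuple (bidx V)}].
rewrite (@cint_finite _ _ _ _ _ [seq (i, w) | i <- enum (bidx V), w <- S]) /=.
- rewrite big_allpairs_dep big_enum mlext_cons; apply: eq_bigr => i _.
  rewrite big_map big_enum scaler_sumr; apply: eq_bigr => w _.
  by rewrite scalerA.
- apply: allpairs_uniq; rewrite ?enum_uniq //.
    by rewrite map_inj_uniq ?enum_uniq //; apply: val_inj.
  by move=> [? ?] [].
move=> [i w] iw; rewrite /htens_coef /tens_coef /=.
case: eqP => [ws|]; last by rewrite mulr0.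
case/negP: iw; apply: allpairs_f; first by rewrite mem_enum.
by apply/mapP; rewrite -ws; exists (in_tuple w); rewrite // mem_enum.
Qed.

Lemma tens_coef_size xs w :
  size xs != size w -> tens xs w = 0.
Proof. by rewrite /= /tens_coef eq_sym => /negbTE ->. Qed.

Lemma tens1 x i :
  tens [:: x] [:: i] = ncoord x i.
Proof. by rewrite /= tens_coef_cons /tens_coef eqxx big_nil mulr1. Qed.

(** Each element carries a chosen shifted degree, since words will mix basis vectors with values of
    [m] and [h], whose degree cannot be read off when they vanish. *)
Definition shomog_seq (zs : seq (int * VL)) :=
  forall z, z \in zs -> ext_shomog z.1 z.2.

Definition sdegs (zs : seq (int * VL)) : int := \sum_(z <- zs) z.1.

Definition hword w : seq (int * VL) := [seq (sdeg i, nvec R i) | i <- w].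

Lemma nvec_shomog i : ext_shomog (sdeg i) (@nvec R K V i).
Proof.
move=> j p; rewrite ncoord_nvec; case: eqP => // -> /=.
by rewrite /nov_one_coef /= /nov_one_coef; case: eqP => // -> _;
  rewrite mul0r addr0.
Qed.

Lemma shomog_hword w : shomog_seq (hword w).
Proof. by move=> z /mapP[i _ ->]; apply: nvec_shomog. Qed.

Lemma snd_hword w : map snd (hword w) = map (@nvec R K V) w.
Proof. by rewrite -map_comp. Qed.

Lemma sdegs_hword w : sdegs (hword w) = wdeg w.
Proof. by rewrite /sdegs big_map. Qed.

(** As e has degree 2, the basis vectors occurring in x have degree d only modulo 2, which is all
    that signs see. *)
Lemma shomog_odd (d : int) x i : ext_shomog d x -> ncoord x i != 0 ->
  odd `|sdeg i|%N = odd `|d|%N.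
Proof.
move=> xd xi; have [p xp] : exists p, ncoord x i p <> 0.
  apply: contrapT => np; case/eqP: xi; apply: nov_eqP => p.
  by apply: contrapT => xp; apply: np; exists p.
by rewrite -(xd i p xp); lia.
Qed.

Lemma tens_coef_odd zs w : shomog_seq zs -> tens_coef (map snd zs) w != 0 ->
  odd `|wdeg w|%N = odd `|sdegs zs|%N.
Proof.
rewrite /wdeg /sdegs.
elim: zs w => [|[d x] zs IH] [|i w] /= hz; rewrite ?big_nil //=;
  try by rewrite /tens_coef eqxx.
rewrite tens_coef_cons => nz; rewrite !big_cons /= odd_abszD [RHS]odd_abszD.
have xi : ncoord x i != 0 by apply: contra_neq nz => ->; rewrite mul0r.
have xw : tens_coef (map snd zs) w != 0.
  by apply: contra_neq nz => ->; rewrite mulr0.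
rewrite (shomog_odd (hz _ (mem_head _ _)) xi) IH // => z zzs.
by apply: hz; rewrite inE zzs orbT.
Qed.

Lemma sdegs_cons z zs : sdegs (z :: zs) = z.1 + sdegs zs.
Proof. exact: big_cons. Qed.

Lemma sdegs_cat zs zs' : sdegs (zs ++ zs') = sdegs zs + sdegs zs'.
Proof. exact: big_cat. Qed.

Lemma shomog_seq_cat zs zs' :
  shomog_seq zs -> shomog_seq zs' -> shomog_seq (zs ++ zs').
Proof. by move=> hz hz' z; rewrite mem_cat => /orP[/hz|/hz']. Qed.

Lemma shomog_seq_take n zs : shomog_seq zs -> shomog_seq (take n zs).
Proof. by move=> hz z /mem_take/hz. Qed.

Lemma shomog_seq_drop n zs : shomog_seq zs -> shomog_seq (drop n zs).
Proof. by move=> hz z /mem_drop/hz. Qed.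

End Tensors.

Lemma mlext_ncoord (R : realType) (K : fieldType)
    (V W : gradedSpace K) (f : seq (bidx V) -> nov_ext R W)
    (xs : seq (nov_ext R V)) i :
  mlext (fun w => ncoord (f w) i : (novikov R K)^o) xs = ncoord (mlext f xs) i.
Proof.
by rewrite /mlext ncoord_sum; apply: eq_bigr => w _; rewrite ncoordZ.
Qed.

Lemma bvec_sum (K : fieldType) (V : gradedSpace K) (v : V) :
  v = \sum_i bcoord i v *: bvec i.
Proof.
rewrite {1}(@coord_basis _ _ fullv _ (in_tuple (hbasis V)) v) ?memvf //.
exact: hbasisP.
Qed.

Lemma m_multilinear (R : realType) (K : fieldType) (D : ainfData R K) :
  multilinear (@m R K D).
Proof. exact: multilinear_mlext. Qed.

(** * Cyclic symmetry over the Novikov ring *)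

Section Cyclic.
Variables (R : realType) (K : fieldType) (A : cyclicAinf R K).
Local Notation Lam := (novikov R K).
Local Notation AL := (nov_ext R A).
Local Notation G := (gap_set (ai_gap A)).
Implicit Types (x y : AL) (xs : seq AL) (w : seq (bidx A)).

Lemma pairing_linear_l z : linear (fun x => pairing x z : Lam^o).
Proof.
move=> a x y; rewrite /pairing scaler_sumr -big_split; apply: eq_bigr => i _ /=.
rewrite scaler_sumr -big_split; apply: eq_bigr => j _ /=.
rewrite ncoordD ncoordZ mulrDl scalerDr; congr (_ + _).
by rewrite -mulrA -[a *: _]/(a * _) [RHS]mulrC -scalerAl [in RHS]mulrC.
Qed.

Lemma pairing_linear_r z : linear (fun y => pairing z y : Lam^o).
Proof.
move=> a x y; rewrite /pairing scaler_sumr -big_split; apply: eq_bigr => i _ /=.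
rewrite scaler_sumr -big_split; apply: eq_bigr => j _ /=.
rewrite ncoordD ncoordZ mulrDr scalerDr; congr (_ + _).
by rewrite mulrCA -[a *: _]/(a * _) [RHS]mulrC -scalerAl [in RHS]mulrC.
Qed.

Definition pairing_left z : AL -> Lam^o := fun x => pairing x z.

HB.instance Definition _ z :=
  GRing.isLinear.Build Lam AL Lam^o _ (pairing_left z) (pairing_linear_l z).

Lemma pairing_suml (I : Type) (r : seq I) (P : pred I) (F : I -> AL) z :
  pairing (\sum_(i <- r | P i) F i) z = \sum_(i <- r | P i) pairing (F i) z.
Proof. exact: (linear_sum (pairing_left z)). Qed.

Lemma pairingZl a x z : pairing (a *: x) z = a * pairing x z.
Proof. exact: (linearZ_LR (pairing_left z)). Qed.

Lemma pairing_nvec_r x j :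
  pairing x (nvec R j) = \sum_i ca_pair A (bvec i) (bvec j) *: ncoord x i.
Proof.
apply: eq_bigr => i _; rewrite (bigD1 j) //= ncoord_nvec eqxx mulr1.
rewrite big1 ?addr0 // => k kj.
by rewrite ncoord_nvec (negbTE kj) mulr0 scaler0.
Qed.

(** Extracting the coefficient of T^l e^q isolates the single operation of index (l, 2q), to which
    the cyclicity axiom applies. *)
Lemma pairing_m_word w j (p : R * int) :
  pairing (@m_word R K A w) (nvec R j) p =
    if `[< G (p.1, p.2 * 2) >]
    then ca_pair A (ai_ops (p.1, p.2 * 2) (map (@bvec K A) w)) (bvec j) else 0.
Proof.
rewrite pairing_nvec_r nov_coef_sum.
under eq_bigr => i _ do rewrite nov_coefZ /ncoord ffunE /= /m_coef.
case: asboolP => _; last by rewrite big1 // => i _; rewrite mulr0.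
set v := ai_ops _ _; rewrite [in RHS](bvec_sum v) linear_sumlz /=.
by apply: eq_bigr => i _; rewrite linearZl_LR /= mulrC.
Qed.

Lemma pairing_cyclic_word i w :
  pairing (@m_word R K A (belast i w)) (nvec R (last i w)) =
  ksign Lam (sdeg i * wdeg w) * pairing (@m_word R K A w) (nvec R i).
Proof.
apply: nov_eqP => p.
have -> : (ksign Lam (sdeg i * wdeg w) *
    pairing (@m_word R K A w) (nvec R i)) p =
    ksign K (sdeg i * wdeg w) * pairing (@m_word R K A w) (nvec R i) p.
  rewrite !ksignE; case: (odd _); rewrite ?expr1 ?expr0 ?mulN1r ?mul1r //.
rewrite !pairing_m_word; case: asboolP => [Gp|_]; last by rewrite mulr0.
have e : all2 (fun (y : A) c => y \in gr A c) (map (@bvec K A) w)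
    [seq (hdegs A)`_k | k : bidx A <- w].
  elim: w => //= k w ->; rewrite andbT; exact: (hbasis_deg (ltn_ord k)).
have := ca_cyclic Gp (hbasis_deg (ltn_ord i)) e.
have -> : belast (hbasis A)`_i (map (@bvec K A) w) =
  map (@bvec K A) (belast i w).
  by elim: w i {e} => //= k w IH i; rewrite IH.
by rewrite (last_map (@bvec K A)) big_map.
Qed.

Lemma pairing_skew (c d : int) x y : ext_shomog c x -> ext_shomog d y ->
  pairing x y = - (ksign Lam (c * d) * pairing y x).
Proof.
move=> xc yd; rewrite /pairing [in RHS]exchange_big mulr_sumr -sumrN.
apply: eq_bigr => i _; rewrite mulr_sumr -sumrN; apply: eq_bigr => j _.
have [->|xi] := eqVneq (ncoord x i) 0;
  first by rewrite mulr0 mul0r !scaler0 mulr0 oppr0.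
have [->|yj] := eqVneq (ncoord y j) 0;
  first by rewrite mulr0 mul0r !scaler0 mulr0 oppr0.
rewrite (ca_skew (hbasis_deg (ltn_ord i)) (hbasis_deg (ltn_ord j))).
rewrite !ksignE -/(sdeg i) -/(sdeg j) !abszM !oddM.
rewrite (shomog_odd xc xi) (shomog_odd yd yj) [ncoord y j * _]mulrC.
by case: (_ && _); rewrite ?expr1 ?expr0 ?mulN1r ?mul1r ?opprK ?scaleNr.
Qed.

(** Joining head and tail makes m^+ a function of lists, so that it can be treated as a multilinear
    map. *)
Definition mplus_list xs : Lam := if xs is x :: xs' then mplus_seq x xs' else 0.

Lemma mplus_rcons xs z : mplus_list (rcons xs z) = pairing (m xs) z.
Proof. by case: xs => //= x xs; rewrite /mplus_seq belast_rcons last_rcons. Qed.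

Lemma mplus_multilinear : multilinear (mplus_list : _ -> Lam^o).
Proof.
move=> s t a x y; case/lastP: t => [|t z].
  by rewrite !cats1 !mplus_rcons pairing_linear_r.
rewrite -!rcons_cons -!rcons_cat !mplus_rcons.
by rewrite m_multilinear pairing_linear_l.
Qed.

Lemma mplus_htens x xs : mplus (htens x xs) = mplus_seq x xs.
Proof. exact: (cint_htens x xs mplus_multilinear). Qed.

Lemma mplus_cyclic (d : int) x (zs : seq (int * AL)) :
  ext_shomog d x -> shomog_seq zs ->
  mplus_seq x (map snd zs) =
    ksign Lam (d * sdegs zs) * pairing (m (map snd zs)) x.
Proof.
(* The sign in [g] is frozen at the degrees of x and [zs], which keeps [g] multilinear; on the basis
   words that occur it has the parity required by [pairing_cyclic_word]. *)
move=> xd hz; pose g (l : seq AL) : Lam^o :=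
  if l is y :: l' then ksign Lam (d * sdegs zs) * pairing (m l') y else 0.
have g_ml : multilinear g.
  move=> [|u s] t a y z /=.
    by rewrite pairing_linear_r mulrDr; congr (_ + _); exact: mulrCA.
  rewrite m_multilinear pairing_linear_l mulrDr.
  congr (_ + _); exact: mulrCA.
rewrite -[LHS]/(mplus_list (x :: map snd zs)) -[RHS]/(g (x :: map snd zs)).
rewrite -(mlext_multilinear _ mplus_multilinear) -(mlext_multilinear _ g_ml).
apply: (@eq_mlext _ _ _ Lam^o) => -[|i w] nz; first by [].
have h : shomog_seq ((d, x) :: zs).
  by move=> z; rewrite inE => /predU1P[->|/hz].
have := tens_coef_odd hz; move: nz; rewrite tens_coef_cons => nz /(_ w) wz.
have xi : ncoord x i != 0 by apply: contra_neq nz => ->; rewrite mul0r.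
have xw : tens_coef (map snd zs) w != 0.
  by apply: contra_neq nz => ->; rewrite mulr0.
have e j v : map (@nvec R K A) (belast j v) =
    belast (nvec R j) (map (@nvec R K A) v) by elim: v j => //= k v ->.
rewrite /= /mplus_seq -e last_map /m !mlext_nvec pairing_cyclic_word.
by rewrite !ksignE !abszM !oddM (shomog_odd xd xi) wz.
Qed.

End Cyclic.

(** * Block decompositions *)

Lemma sum_decomps_single (T : eqType) (V : nmodType) (s : seq T)
    (F : seq (seq T) -> V) :
  s != [::] -> (forall d, size d != 1 -> F d = 0) ->
  \sum_(d <- decomps s) F d = F [:: s].
Proof.
move=> s0 F0.
have s_d : [:: s] \in decomps s by rewrite mem_decomps /= cats0 eqxx inE eq_sym.
rewrite (bigD1_seq _ s_d (uniq_decomps s)) /= big1_seq ?addr0 // => d.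
case/andP=> ds; rewrite mem_decomps => /andP[/eqP fd _]; apply: F0.
by apply: contra_neq ds; case: d fd => [|b [|]] //=; rewrite cats0 => ->.
Qed.

Section SumDecomps.
Variables (T : Type) (V : nmodType).
Implicit Types (s : seq T) (f : seq (seq T) -> V).

Lemma sum_decomps_cons x s f :
  \sum_(d <- decomps (x :: s)) f d =
  \sum_(d <- decomps s)
    (if d is b :: d' then f ([:: x] :: d) + f ((x :: b) :: d')
     else f [:: [:: x]]).
Proof.
rewrite /= big_flatten big_map; apply: eq_bigr => -[|b d] _ /=.
  by rewrite big_seq1.
by rewrite big_cons big_seq1.
Qed.

Lemma eq_sum_decomps x s f g : (forall b d, f (b :: d) = g (b :: d)) ->
  \sum_(d <- decomps (x :: s)) f d = \sum_(d <- decomps (x :: s)) g d.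
Proof.
move=> fg; rewrite !sum_decomps_cons; apply: eq_bigr => -[|b d] _ /=.
  exact: fg.
by rewrite !fg.
Qed.

(** Isolating the block of x matches the terms of [hhat_word] in which the underlined block begins
    with x_0. *)
Lemma sum_decomps_first x s f :
  \sum_(d <- decomps (x :: s)) f d =
  \sum_(j < (size s).+1)
    \sum_(d <- decomps (drop j s)) f ((x :: take j s) :: d).
Proof.
elim: s x f => [|y s IH] x f.
  by rewrite big_ord1 /= !big_seq1.
(* Either x is a block by itself, or it is prepended to the first block of a decomposition of the
   tail; [g] collects the second case. *)
pose g d := if d is b :: d' then f ((x :: b) :: d') else 0.
rewrite sum_decomps_cons big_ord_recl drop0 take0.
rewrite (@eq_sum_decomps _ _ _ (fun d => f ([:: x] :: d) + g d)) // big_split.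
by congr (_ + _); rewrite (IH y g).
Qed.

(** The last block is the one that m^+ puts in the second slot of the pairing. *)
Lemma sum_decomps_last s f : (0 < size s)%N ->
  \sum_(d <- decomps s) f d =
  \sum_(b < size s) \sum_(d <- decomps (take b s)) f (rcons d (drop b s)).
Proof.
elim: s f => // x s IH f _; rewrite sum_decomps_cons.
case: s IH => [|y s] IH; first by rewrite big_ord1 /= !big_seq1.
(* The cut b = 0 of the tail gives two terms, the whole list as one block and x split off; these are
   the cuts b = 0 and b = 1 of the longer list. *)
rewrite IH // [RHS]big_ord_recl [X in _ = X + _]big_seq1.
rewrite [LHS]big_ord_recl [X in _ = _ + X]big_ord_recl.
rewrite [X in X + _ = _]big_seq1 [X in _ = _ + (X + _)]big_seq1.
rewrite [X in X + _ = _]/= -addrA addrCA; congr (_ + (_ + _));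
  apply: eq_bigr => b _.
rewrite [RHS]sum_decomps_cons; exact: eq_sum_decomps.
Qed.

End SumDecomps.

(** * Homomorphisms and cuts of cyclic words *)

Section Homomorphism.
Variables (R : realType) (K : fieldType) (A B : ainfData R K).
Local Notation Lam := (novikov R K).
Local Notation AL := (nov_ext R A).
Local Notation BL := (nov_ext R B).
Variable h : seq AL -> BL.
Hypothesis hH : is_ainf_hom h.
Local Notation nv := (map (@nvec R K A)).

(* Only the decomposition into a single block contributes to length one. *)
Lemma coh_tens1 xs i : xs != [::] -> coh h (tens xs) [:: i] = ncoord (h xs) i.
Proof.
move=> xs0; rewrite -[LHS]/(cint _ (tens xs)) cint_tens.
rewrite -(mlext_multilinear xs (ah_multilinear hH)) -mlext_ncoord.
apply: (@eq_mlext _ _ _ Lam^o) => w nz.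
rewrite cf_coef_sum sum_decomps_single ?tens1 //.
- move: nz; rewrite /tens_coef; case: (size w =P _) => [ws _|_];
  last by rewrite eqxx.
  by rewrite -size_eq0 size_map ws size_eq0.
- by move=> d d1; rewrite tens_coef_size // size_map.
Qed.

(** Applying m_q to a word of length n leaves length n - q + 1, so only q = n reaches words of
    length one. *)
Lemma dhat_tens1 (D : ainfData R K) (xs : seq (nov_ext R D)) i :
  dhat (tens xs) [:: i] = ncoord (m xs) i.
Proof.
rewrite -[LHS]/(cint _ (tens xs)) cint_tens -mlext_ncoord.
apply: (@eq_mlext _ _ _ Lam^o) => w nz; rewrite cf_coef_sum.
rewrite big_ord_recr /= big1 => [|k _].
  rewrite add0r /mhat_word leqnn subnn big_ord1 /= take0 drop0 take_size.
  rewrite drop_size /wdeg big_nil /ksign /= expr0 scale1r.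
  rewrite -[LHS]/(tens [:: m _] [:: i]) tens1.
  by rewrite /m mlext_nvec.
rewrite /mhat_word ltnW // cf_coef_sum big1 // => j _.
rewrite -[LHS]/(_ * tens _ [:: i] : Lam) tens_coef_size ?mulr0 //.
have := ltn_ord j; have := ltn_ord k; rewrite size_cat /= !size_map.
rewrite size_take size_drop; case: ifP; lia.
Qed.

(* The length-one component of the comparison of the two differentials. *)
Lemma ainf_hom_relation w :
  \sum_(d <- decomps (nv w)) m (map h d) =
  \sum_(q < (size w).+1) \sum_(p < (size w - q).+1)
    ksign Lam (wdeg (take p w)) *:
    h (nv (take p w) ++ m (nv (take q (drop p w))) :: nv (drop (p + q) w)).
Proof.
apply: nov_extP => i; rewrite !ncoord_sum.
transitivity (dhat (coh h (tens (nv w))) [:: i]).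
  rewrite [coh h _]cext_tens /dhat -[RHS]/(cint _ (\sum_(d <- _) _)).
  rewrite linear_sum /=.
  by apply: eq_bigr => d _; rewrite -dhat_tens1.
rewrite -(ah_comm hH) [dhat _]cext_tens -[LHS]/(cint _ (\sum_(k < _) _)).
rewrite linear_sum; apply: eq_bigr => q _; rewrite ncoord_sum /mhat_word.
rewrite -ltnS ltn_ord linear_sum; apply: eq_bigr => p _.
rewrite linearZ ncoordZ -coh_tens1 //.
by case: (take p w).
Qed.

Lemma hom_shomog zs : zs != [::] -> shomog_seq zs ->
  ext_shomog (sdegs zs) (h (map snd zs)).
Proof.
move=> zs0 hz; rewrite /sdegs -(big_map fst xpredT id).
apply: (ah_degree hH); rewrite ?size_map //.
  by case: zs zs0 {hz}.
move=> j js; rewrite (nth_map (0, 0)) // (nth_map (0, 0)) //.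
by apply: hz; apply: mem_nth.
Qed.
End Homomorphism.

Lemma m_shomog (R : realType) (K : fieldType) (A : ainfData R K) zs :
  is_ainf A -> shomog_seq zs ->
  ext_shomog (sdegs zs + 1) (m (map snd zs) : nov_ext R A).
Proof.
move=> aA hz; rewrite /sdegs -(big_map fst xpredT id).
apply: (ai_degree aA); rewrite ?size_map // => j js.
by rewrite (nth_map (0, 0)) // (nth_map (0, 0)) //; apply: hz; apply: mem_nth.
Qed.

(** * Antisymmetric functions of two cuts *)

Section AntisymSum.
Variables (V : zmodType) (n : nat) (F : nat -> nat -> V).

(** If F is extended by F a b = - F b a for b < a and by 0 on the diagonal, this says that every row
    sum vanishes. *)
Hypothesis F_row : forall a, (a < n)%N ->
  \sum_(a.+1 <= b < n) F a b = \sum_(0 <= b < a) F b a.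

(* Moving the cut from c to c.+1 changes the sum by the row sum at c. *)
Lemma sum_cut c : (c <= n)%N ->
  \sum_(0 <= a < c) \sum_(c <= b < n) F a b = 0.
Proof.
elim: c => [|c IH] cn; first by rewrite big_geq.
rewrite big_nat_recr //= (F_row cn) -big_split big_nat /=.
transitivity (\sum_(0 <= a < c) \sum_(c <= b < n) F a b);
  last by rewrite IH // ltnW.
rewrite [RHS]big_nat; apply: eq_bigr => a ac.
by rewrite [in RHS]big_ltn // addrC.
Qed.
End AntisymSum.

(** * Segments of words *)

Definition slice (T : Type) a b (s : seq T) := take (b - a) (drop a s).

Section Slice.
Variable T : Type.
Implicit Types s : seq T.

Lemma take_slice a b s : (a <= b)%N -> take b s = take a s ++ slice a b s.
Proof. by move=> ab; rewrite /slice -takeD subnKC. Qed.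

Lemma drop_slice a b s : (a <= b)%N -> drop a s = slice a b s ++ drop b s.
Proof.
move=> ab; rewrite -{1}(cat_take_drop (b - a) (drop a s)) drop_drop.
by rewrite subnK.
Qed.

Lemma size_slice a b s : (b <= size s)%N -> size (slice a b s) = (b - a)%N.
Proof. by move=> bs; rewrite size_takel // size_drop leq_sub2r. Qed.

Lemma take_of_slice a b p s : (p <= b - a)%N ->
  take p (slice a b s) = slice a (a + p) s.
Proof. by move=> pab; rewrite /slice take_takel ?addKn. Qed.

Lemma drop_of_slice a b p s : (p <= b - a)%N ->
  drop p (slice a b s) = slice (a + p) b s.
Proof.
by move=> pab; rewrite /slice -{1}(subnK pab) -take_drop drop_drop addnC subnDA.
Qed.

End Slice.

(** * Pairings of the two blocks of a cut cyclic word *)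

Section CyclicHom.
Variables (R : realType) (K : fieldType) (A B : cyclicAinf R K).
Local Notation Lam := (novikov R K).
Local Notation AL := (nov_ext R A).
Local Notation BL := (nov_ext R B).
Variable h : seq AL -> BL.
Hypothesis hC : is_cyclic_hom h.
Implicit Types zs : seq (int * AL).

(* The cyclic word zs is cut before its letters a <= b; the sign is that of the
   rotation carrying the first a letters to the end. *)
Definition cut_pairing zs a b : Lam :=
  ksign Lam (sdegs (take a zs) * sdegs (drop a zs)) *
  pairing (h (map snd (slice a b zs))) (h (map snd (drop b zs ++ take a zs))).

Lemma cut_pairing_swap zs a b : shomog_seq zs -> (b < a < size zs)%N ->
  cut_pairing zs b a =
  - (ksign Lam (sdegs (take a zs) * sdegs (drop a zs)) *
    pairing (h (map snd (drop a zs ++ take b zs)))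
      (h (map snd (slice b a zs)))).
Proof.
move=> hz /andP[ba az]; rewrite /cut_pairing.
have hY : shomog_seq (slice b a zs) by apply/shomog_seq_take/shomog_seq_drop.
have hZX : shomog_seq (drop a zs ++ take b zs).
  by apply: shomog_seq_cat; [apply: shomog_seq_drop|apply: shomog_seq_take].
rewrite (pairing_skew (hom_shomog (ch_hom hC) _ hY)
  (hom_shomog (ch_hom hC) _ hZX)).
(* With X, Y, Z the degrees of the three consecutive pieces, the rotation and skew-symmetry signs
   give X(Y+Z) + Y(Z+X), which is (X+Y)Z modulo 2. *)
- rewrite (take_slice zs (ltnW ba)) (drop_slice zs (ltnW ba)) !sdegs_cat.
  rewrite mulrN; congr (- _); rewrite mulrA; congr (_ * _).
  rewrite !parityE -signr_addb; congr (_ ^+ nat_of_bool _).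
  by do 3!case: (odd `|sdegs _|).
- by rewrite -size_eq0 size_slice 1?ltnW // subn_eq0 -ltnNge.
- by rewrite -size_eq0 size_cat size_drop addn_eq0 subn_eq0 leqNgt az.
Qed.

(** This is the second cyclicity condition on h for the word rotated to start at letter a. Cuts that
    wrap past the end of [zs] are brought back to the other side by skew-symmetry. *)
Lemma cut_pairing_row zs a :
  shomog_seq zs -> (3 <= size zs)%N -> (a < size zs)%N ->
  \sum_(a.+1 <= b < size zs) cut_pairing zs a b =
  \sum_(0 <= b < a) cut_pairing zs b a.
Proof.
move=> hz z3 az; apply/eqP; rewrite -subr_eq0.
have := @ch_cyclic _ _ _ _ _ hC (map snd (drop a zs ++ take a zs)).
have sz : size (drop a zs ++ take a zs) = size zs.
  by rewrite size_cat addnC -size_cat cat_take_drop.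
rewrite size_map sz => /(_ z3).
(* From index [size zs - a] on, the second cut has wrapped around to a position b < a. *)
rewrite (@big_cat_nat _ _ _ (size zs - a)) ?subn_gt0 ?leq_subr //=.
rewrite -(add1n a) big_addn [X in _ + X = 0 -> _](_ : _ =
  \sum_(0 <= b < a) pairing (h (map snd (drop a zs ++ take b zs)))
    (h (map snd (slice b a zs)))).
  pose eps := ksign Lam (sdegs (take a zs) * sdegs (drop a zs)).
  move=> /(congr1 (fun x => eps * x)); rewrite mulr0 mulrDr !mulr_sumr => e.
  apply/eqP; apply: etrans e; congr (_ + _).
    rewrite !big_nat; apply: eq_bigr => i /andP[i1 ia]; rewrite /cut_pairing.
    rewrite /slice addnK -map_take -map_drop takel_cat ?size_drop;
      last exact: ltnW.
    by rewrite drop_cat size_drop ia drop_drop.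
  rewrite -sumrN !big_nat; apply: eq_bigr => b /= ba.
  by rewrite cut_pairing_swap ?ba ?opprK.
rewrite -{1}(add0n (size zs - a)%N) big_addn subKn; last exact: ltnW.
rewrite !big_nat; apply: eq_bigr => b /= ba.
rewrite -map_take -map_drop take_cat drop_cat size_drop ltnNge leq_addl /=.
by rewrite addnK take_takel 1?ltnW // /slice take_drop subnK // ltnW.
Qed.

Lemma cut_pairing_sum zs c :
  shomog_seq zs -> (3 <= size zs)%N -> (c <= size zs)%N ->
  \sum_(0 <= a < c) \sum_(c <= b < size zs) cut_pairing zs a b = 0.
Proof. by move=> hz z3; apply: sum_cut => a az; apply: cut_pairing_row. Qed.

End CyclicHom.

(** * Invariance of m^+ on basis words *)

Lemma decomps_map (T T' : Type) (f : T -> T') s :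
  decomps (map f s) = map (map (map f)) (decomps s).
Proof.
elim: s => //= x s ->; rewrite map_flatten -!map_comp; congr flatten.
by apply: eq_map => -[|b d].
Qed.

(** * Reindexing of nested sums *)

Section SumReindex.
Variable V : nmodType.

Lemma sum_triangleC n (G : nat -> nat -> V) :
  \sum_(q < n) \sum_(p < n - q) G q p = \sum_(p < n) \sum_(q < n - p) G q p.
Proof.
transitivity (\sum_(q < n) \sum_(p < n | (q + p < n)%N) G q p).
  apply: eq_bigr => q _; rewrite (big_ord_widen n (G q)) ?leq_subr //.
  by apply: eq_bigl => p; rewrite ltn_subRL.
rewrite (exchange_big_dep xpredT) //=; apply: eq_bigr => p _.
rewrite (big_ord_widen n (fun q => G q p)) ?leq_subr //.
by apply: eq_bigl => q; rewrite ltn_subRL addnC.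
Qed.

Lemma sum_nat_shift m n (F : nat -> V) :
  \sum_(m <= i < n) F i = \sum_(i < n - m) F (i + m)%N.
Proof. by rewrite -[in LHS](add0n m) big_addn big_mkord. Qed.

(** The relation for h indexes subintervals by length q and offset p, while the argument on cuts
    needs the endpoints c and e. *)
Lemma sum_triangle_shift a b (G : nat -> nat -> V) : (a <= b)%N ->
  \sum_(q < (b - a).+1) \sum_(p < (b - a - q).+1) G (a + p)%N (a + p + q)%N =
  \sum_(a <= c < b.+1) \sum_(c <= e < b.+1) G c e.
Proof.
move=> ab; rewrite sum_nat_shift subSn //.
transitivity (\sum_(q < (b - a).+1)
  \sum_(p < (b - a).+1 - q) G (a + p)%N (a + p + q)%N).
  by apply: eq_bigr => q _; rewrite subSn // -ltnS.
rewrite (sum_triangleC _ (fun q p => G (a + p)%N (a + p + q)%N));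
  apply: eq_bigr => p _.
rewrite sum_nat_shift [(p + a)%N]addnC subnDA (subSn ab).
by apply: eq_bigr => q _; rewrite [(q + _)%N]addnC.
Qed.

Lemma sum_nat_cond m p n (F : nat -> V) : (p <= n)%N ->
  \sum_(m <= i < p) F i = \sum_(i < n) if (m <= i < p)%N then F i else 0.
Proof.
move=> pn; rewrite (big_nat_widen _ _ n) // (big_nat_widenl _ 0) // big_mkord.
by rewrite -big_mkcond; apply: eq_bigl => i; rewrite andbC.
Qed.

Lemma sum_ord_cond p n (F : nat -> V) : (p <= n)%N ->
  \sum_(i < p) F i = \sum_(i < n) if (i < p)%N then F i else 0.
Proof. by move=> pn; rewrite -big_mkcond (big_ord_widen n F). Qed.

(** Both sides range over a <= c <= e <= b < n. The exchange fixes the inner interval [c, e) and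
    lets the outer cuts a and b vary. *)
Lemma sum_nested_exchange n (U : nat -> nat -> nat -> nat -> V) :
  \sum_(b < n) \sum_(a < b.+1)
    \sum_(a <= c < b.+1) \sum_(c <= e < b.+1) U a c e b =
  \sum_(c < n) \sum_(c <= e < n)
    \sum_(0 <= a < c.+1) \sum_(e <= b < n) U a c e b.
Proof.
transitivity (\sum_(b < n) \sum_(a < n) \sum_(c < n) \sum_(e < n)
   if (a <= c <= e)%N && (e <= b)%N then U a c e b else 0).
  apply: eq_bigr => b _.
  rewrite (sum_ord_cond (fun a =>
    \sum_(a <= c < b.+1) \sum_(c <= e < b.+1) U a c e b) (ltn_ord b)).
  apply: eq_bigr => a _.
  case: ifP => [_|ab]; last first.
    rewrite big1 // => c _; rewrite big1 // => e _; case: ifP => //; lia.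
  rewrite (@sum_nat_cond _ _ n) //; apply: eq_bigr => c _.
  case: ifP => [ac|ac]; last first.
    rewrite big1 // => e _; case: ifP => //; lia.
  rewrite (@sum_nat_cond _ _ n) //; apply: eq_bigr => e _.
  by congr (if _ then _ else _); lia.
transitivity (\sum_(c < n) \sum_(e < n) \sum_(a < n) \sum_(b < n)
   if (a <= c <= e)%N && (e <= b)%N then U a c e b else 0); last first.
  apply: eq_bigr => c _.
  rewrite (@sum_nat_cond _ _ n) //; apply: eq_bigr => e _.
  case: ifP => [ce|ce]; last first.
    rewrite big1 // => a _; rewrite big1 // => b _; case: ifP => //;
      have := ltn_ord e; lia.
  rewrite (@sum_nat_cond _ _ n) //; apply: eq_bigr => a _.
  case: ifP => [ac|ac]; last first.
    rewrite big1 // => b _; case: ifP => //; lia.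
  rewrite (@sum_nat_cond _ _ n) //; apply: eq_bigr => b _.
  by congr (if _ then _ else _); have := ltn_ord b; lia.
rewrite exchange_big.
under eq_bigr => a _ do rewrite exchange_big.
rewrite exchange_big; apply: eq_bigr => c _.
under eq_bigr => a _ do rewrite exchange_big.
by rewrite exchange_big.
Qed.

End SumReindex.

(** * Expansion of m^+ of the image of a basis word *)

Section Word.
Variables (R : realType) (K : fieldType) (A B : cyclicAinf R K).
Local Notation Lam := (novikov R K).
Local Notation AL := (nov_ext R A).
Local Notation BL := (nov_ext R B).
Variable h : seq AL -> BL.
Hypothesis hC : is_cyclic_hom h.
Local Notation nv := (map (@nvec R K A)).
Implicit Types s C : seq (bidx A).

(** This is the m_B side of the A-infinity relation for h. *)
Definition block_sum s : BL := \sum_(d <- decomps (nv s)) m (map h d).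

(** The sign of rotating x to the end depends only on the total degree of s, so it is the same for
    all decompositions and factors out. *)
Lemma sum_mplus_blocks s (e : int) (x : BL) : ext_shomog e x ->
  \sum_(d <- decomps (nv s)) mplus_seq x (map h d) =
  ksign Lam (e * wdeg s) * pairing (block_sum s) x.
Proof.
move=> xe; rewrite pairing_suml mulr_sumr decomps_map !big_map.
apply: eq_big_seq => d; rewrite mem_decomps => /andP[/eqP <- d0].
pose zs := [seq (wdeg b, h (nv b)) | b <- d].
have hz : shomog_seq zs.
  move=> z /mapP[b bd ->] /=; rewrite -(sdegs_hword R) -snd_hword.
  apply: (hom_shomog (ch_hom hC)); last exact: shomog_hword.
  by rewrite -size_eq0 size_map size_eq0; apply: contraNneq d0 => <-.
have -> : wdeg (flatten d) = sdegs zs.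
  by rewrite /wdeg big_flatten /sdegs !big_map.
have -> : map h (map nv d) = map snd zs by rewrite -!map_comp.
exact: mplus_cyclic.
Qed.

(* The contribution of the cyclic word C cut into C[a, b), to which the block
   decompositions apply, and the rest, which contains the last letter. *)
Definition cyc_term C a b : Lam :=
  ksign Lam (wdeg (take a C) * wdeg (drop a C)) *
  pairing (block_sum (slice a b C)) (h (nv (drop b C ++ take a C))).

Lemma wdeg_cat s s' : wdeg (s ++ s') = wdeg s + wdeg s'.
Proof. exact: big_cat. Qed.

Lemma hom_word_shomog s : s != [::] -> ext_shomog (wdeg s) (h (nv s)).
Proof.
move=> s0; rewrite -(sdegs_hword R) -snd_hword.
apply: (hom_shomog (ch_hom hC)); last exact: shomog_hword.
by rewrite -size_eq0 size_map size_eq0.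
Qed.

Lemma mplus_hhat_word x0 s :
  mplus (hhat_word h (x0, s)) =
  \sum_(b < (size s).+1) \sum_(a < b.+1) cyc_term (x0 :: s) a b.
Proof.
set C := x0 :: s; set k := size s.
pose X i j := \sum_(d <- decomps (nv (take (k - i - j) (drop j s))))
  ksign Lam (wdeg (drop (k - i) s) * wdeg (x0 :: take (k - i) s)) *
  mplus_seq (h (nv (drop (k - i) s ++ x0 :: take j s))) (map h d).
transitivity (\sum_(i < k.+1) \sum_(j < (k - i).+1) X i j).
  rewrite /mplus /= linear_sum; apply: eq_bigr => i _.
  rewrite linear_sum; apply: eq_bigr => j _.
  rewrite linear_sum; apply: eq_bigr => d _.
  by rewrite linearZ; congr (_ * _); apply: mplus_htens.
(* For i = 0 the underlined block starts with x_0: the terms are the decompositions of the whole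
   word, and the last block contains x_k. *)
rewrite big_ord_recl.
have -> : \sum_(j < (k - @ord0 k).+1) X (@ord0 k) j =
  \sum_(b < k.+1) cyc_term C 0 b.
  transitivity (\sum_(d <- decomps (nv C)) mplus_list (map h d)).
    rewrite [nv C]/= sum_decomps_first size_map subn0; apply: eq_bigr => j _.
    rewrite /X !subn0 drop_size -map_drop -map_take.
    rewrite take_oversize ?size_drop //; apply: eq_bigr => d _.
    by rewrite /wdeg big_nil mul0r /ksign expr0 mul1r.
  rewrite sum_decomps_last ?size_map //; apply: eq_bigr => b _.
  rewrite /cyc_term take0 drop0 cats0 /slice drop0 subn0 /wdeg big_nil mul0r.
  rewrite /ksign expr0 mul1r pairing_suml -map_take -map_drop.
  by apply: eq_bigr => d _; rewrite map_rcons mplus_rcons.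
(* For i > 0 the underlined block runs through x_k to x_0 and is rotated into the second slot. Here
   b = k - i, and positions in C exceed those in s by one because of x_0. *)
have -> : \sum_(i < k) \sum_(j < (k - lift ord0 i).+1) X (lift ord0 i) j =
    \sum_(b < k) \sum_(a < b.+1) cyc_term C a.+1 b.+1.
  rewrite (reindex_inj rev_ord_inj); apply: eq_bigr => b _.
  have bk := ltn_ord b.
  have e : (k - lift ord0 (rev_ord b))%N = b by rewrite /= /bump /=; lia.
  rewrite e; apply: eq_bigr => a _; rewrite /X e -mulr_sumr.
  have ab : (a <= b)%N by rewrite -ltnS.
  have db : drop b s != [::] by rewrite -size_eq0 size_drop subn_eq0 -ltnNge.
  rewrite (@sum_mplus_blocks _ (wdeg (drop b s ++ x0 :: take a s))); last first.
    by apply: hom_word_shomog; rewrite -size_eq0 size_cat /= addnS.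
  rewrite mulrA /cyc_term; congr (_ * _).
  rewrite /= -/(slice a b s) (take_slice s ab) (drop_slice s ab).
  (* With X, Y, Z the degrees of [x0 :: take a s], [slice a b s] and [drop b s], the signs of
     [hhat_word] and of the rotation give Z(X+Y) + (Z+X)Y, which is X(Y+Z) modulo 2. *)
  rewrite -!cat_cons !wdeg_cat !parityE -!signr_addb.
  by congr (_ ^+ nat_of_bool _); do 3!case: (odd `|wdeg _|).
rewrite [in LHS]big_ord_recl [in RHS]big_ord_recl big_ord1 -addrA;
  congr (_ + _).
rewrite -big_split; apply: eq_bigr => b _.
by rewrite [in RHS]big_ord_recl.
Qed.

(* The contribution of m_A applied to C[c, e), inside the piece C[a, b). *)
Definition cut_term C a c e b : Lam :=
  ksign Lam (wdeg (take a C) * wdeg (drop a C)) *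
  (ksign Lam (wdeg (slice a c C)) *
   pairing (h (nv (slice a c C) ++ m (nv (slice c e C)) :: nv (slice e b C)))
     (h (nv (drop b C ++ take a C)))).

Lemma cyc_term_relation C a b : (a <= b <= size C)%N ->
  cyc_term C a b = \sum_(a <= c < b.+1) \sum_(c <= e < b.+1) cut_term C a c e b.
Proof.
move=> /andP[ab bC].
rewrite -(sum_triangle_shift (fun c e => cut_term C a c e b) ab).
rewrite /cyc_term /block_sum (ainf_hom_relation (ch_hom hC)) size_slice //.
rewrite pairing_suml mulr_sumr; apply: eq_bigr => q _.
rewrite pairing_suml mulr_sumr; apply: eq_bigr => p _.
have pq : (p + q <= b - a)%N by have := ltn_ord p; have := ltn_ord q; lia.
have pL : (p <= b - a)%N := leq_trans (leq_addr _ _) pq.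
rewrite pairingZl /cut_term take_of_slice // !drop_of_slice // take_of_slice.
  by rewrite addnA.
by rewrite subnDA leq_subRL.
Qed.

(** Contracting C[c, e) to one letter at index c keeps the cut a and moves the cut r + e to r + c +
    1. The letter has degree one more than the interval; that 1 accounts for the sign in front. *)
Lemma cut_term_cut_pairing C a c e r :
  (a <= c <= e)%N -> (e <= size C)%N ->
  let zs := hword R (take c C) ++
    (wdeg (slice c e C) + 1, m (nv (slice c e C))) :: hword R (drop e C) in
  cut_term C a c e (r + e) =
    ksign Lam (wdeg (take c C)) * cut_pairing h zs a (r + c.+1).
Proof.
move=> /andP[ac ce] eC; set y : int * AL := (_, m _); move=> zs;
  have cC := leq_trans ce eC.
have szc : size (hword R (take c C)) = c by rewrite size_map size_takel.
have zs_take : take a zs = hword R (take a C).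
  by rewrite /zs takel_cat ?szc // -map_take take_takel.
have zs_drop : drop a zs = hword R (slice a c C) ++ y :: hword R (drop e C).
  rewrite /zs drop_cat szc; case: ltnP => ca.
    by rewrite -map_drop /slice take_drop subnK.
  have -> : a = c by apply/eqP; rewrite eqn_leq ac.
  by rewrite /slice subnn drop0 take0.
have zs_slice : slice a (r + c.+1) zs =
    hword R (slice a c C) ++ y :: hword R (slice e (r + e) C).
  rewrite [LHS]/slice zs_drop take_cat size_map size_slice //.
  have -> : (r + c.+1 - a < c - a)%N = false by lia.
  have -> : (r + c.+1 - a - (c - a) = r.+1)%N by lia.
  by rewrite /= -map_take /slice addnK.
have zs_drop_r : drop (r + c.+1) zs = hword R (drop (r + e) C).
  rewrite /zs drop_cat szc.
  have -> : (r + c.+1 < c)%N = false by lia.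
  have -> : (r + c.+1 - c = r.+1)%N by lia.
  by rewrite /= -map_drop drop_drop.
rewrite /cut_pairing zs_slice zs_drop_r zs_drop zs_take -map_cat.
rewrite !map_cat /= !snd_hword -map_cat !sdegs_cat /cut_term.
rewrite !mulrA; congr (_ * _).
rewrite sdegs_cons !sdegs_hword /=.
rewrite (drop_slice C ac) (take_slice C ac) (drop_slice C ce) !wdeg_cat.
rewrite !parityE -!signr_addb; congr (_ ^+ nat_of_bool _).
by do 4!case: (odd `|wdeg _|).
Qed.

(** The contracted word has c + 1 + (size C - e) letters, which is at least three outside the
    excluded case. The cuts a <= c < b are those separating the new letter from the last one, so
    [cut_pairing_sum] applies at c + 1. *)
Lemma cut_term_sum0 C c e : (c <= e < size C)%N ->
  ~~ ((c == 0%N) && (e.+1 == size C)) ->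
  \sum_(0 <= a < c.+1) \sum_(e <= b < size C) cut_term C a c e b = 0.
Proof.
move=> /andP[ce eC] nce.
pose y := (wdeg (slice c e C) + 1, m (nv (slice c e C)) : AL).
pose zs := hword R (take c C) ++ y :: hword R (drop e C).
have szs : size zs = (c + (size C - e).+1)%N.
  by rewrite size_cat /= !size_map size_drop size_takel // ltnW //
    (leq_ltn_trans ce).
have hz : shomog_seq zs.
  apply: shomog_seq_cat; first exact: shomog_hword.
  move=> z; rewrite inE => /predU1P[->|]; last exact: shomog_hword.
  rewrite /= -(sdegs_hword R) -snd_hword; apply: m_shomog;
    first exact: ca_axioms.
  exact: shomog_hword.
transitivity (ksign Lam (wdeg (take c C)) *
    \sum_(0 <= a < c.+1) \sum_(c.+1 <= b < size zs) cut_pairing h zs a b).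
  rewrite mulr_sumr !big_nat; apply: eq_bigr => a /= ac.
  rewrite mulr_sumr !sum_nat_shift szs.
  have -> : (c + (size C - e).+1 - c.+1 = size C - e)%N by lia.
  by apply: eq_bigr => r _; rewrite cut_term_cut_pairing ?ce ?andbT // ltnW.
by rewrite (cut_pairing_sum hC) ?mulr0 // szs; lia.
Qed.

Lemma mplus_hhat_wordE x0 s :
  mplus (hhat_word h (x0, s)) = mplus_seq (nvec R x0) (nv s).
Proof.
set C := x0 :: s; set k := size s.
rewrite mplus_hhat_word -/k -/C.
transitivity (\sum_(b < k.+1) \sum_(a < b.+1)
    \sum_(a <= c < b.+1) \sum_(c <= e < b.+1) cut_term C a c e b).
  apply: eq_bigr => b _; apply: eq_bigr => a _.
  by apply: cyc_term_relation; rewrite -ltnS ltn_ord ltnW // ltn_ord.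
(* Every interval with c > 0 contributes 0, and then so does every one with c = 0 and e < k. *)
rewrite (sum_nested_exchange _ (cut_term C)) big_ord_recl
  [X in _ + X]big1 ?addr0; last first.
  move=> c _; rewrite big_nat big1 // => e /andP[ce ek].
  by apply: (@cut_term_sum0 C); rewrite ?ce.
rewrite big_nat_recr //= [X in X + _]big_nat [X in X + _]big1 ?add0r =>
  [|e /andP[_ ek]]; last first.
  by apply: (@cut_term_sum0 C); rewrite /= ?eqSS ?neq_ltn ?ek // ltnW.
(* What survives is a = c = 0 and e = b = k: the pairing of h_1 (m_A (x_0, ..., x_{k-1})) with h_1
   (x_k), which h_1 preserves. *)
rewrite !big_nat1 /cut_term take0 drop0 cats0 /slice !subnn drop0 subn0 !take0 /=.
rewrite /wdeg !big_nil mul0r /ksign expr0 !mul1r.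
rewrite -[RHS]/(mplus_list (nv C)) /C (lastI x0 s) /k -(size_belast x0 s).
rewrite map_rcons mplus_rcons -cats1 take_size_cat // drop_size_cat //.
exact: (ch_iso hC).
Qed.

End Word.

Theorem proposition4p4 (R : realType) (K : fieldType)
  (charK : [pchar K] =i pred0) (A B : cyclicAinf R K)
  (h : seq (nov_ext R A) -> nov_ext R B) (hC : is_cyclic_hom h)
  (alpha : hchain R A) :
  mplus alpha = mplus (hhat h alpha).
Proof.
(* By the Fubini rule both sides integrate a function of basis words against [alpha], so these
   functions are compared word by word. *)
rewrite /mplus /hhat cint_cext; congr (cint _ alpha); apply/funext => -[x0 s].
by rewrite -[RHS]/(mplus _) (mplus_hhat_wordE hC).
Qed.
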